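(* Let $m>1$ be an odd positive integer. One can explicitly compute a finite set of equations $f_1,f_2,\dots,f_r$ defining $\operatorname{MT}(J_m)$; that is, there is an algorithm which, given $m$, outputs (the exponent vectors of) a finite set of equations defining $\operatorname{MT}(J_m)$.
   Context: $J_m/\mathbb{Q}$ is the Jacobian of the smooth projective curve over $\mathbb{Q}$ with affine equation $y^2=x^m+1$, with $m=2g+1$ odd. $V=H^1(J_m(\mathbb{C}),\mathbb{Q})$; $\operatorname{MT}(J_m)$ is the smallest algebraic subgroup of $\operatorname{GL}_V$ defined over $\mathbb{Q}$ whose base change to $\mathbb{R}$ contains the image of $h:\operatorname{Res}_{\mathbb{C}/\mathbb{R}}\mathbb{G}_m\to\operatorname{GL}_{V,\mathbb{R}}$ giving the Hodge structure. Let $\zeta_m=\exp(2\pi i/m)$, $K=\mathbb{Q}(\zeta_m)$ and $\alpha_m:(x,y)\mapsto(\zeta_m x,y)$, an automorphism of the curve. For $1\le i\le 2g$ let $v_i\in H^1(J_m(\mathbb{C}),K)$ be a nonzero eigenvector of $\alpha_m^*$ with eigenvalue $\zeta_m^i$; these form a basis. Let $T=\operatorname{Spec}K[x_1^{\pm1},\dots,x_{2g}^{\pm1}]\subset\operatorname{GL}_{V,K}$ be the diagonal torus in this basis; one has $\operatorname{MT}(J_m)_K\subseteq T$. An equation for $\operatorname{MT}(J_m)$ is a Laurent monomial $f=\prod_j x_j^{d_j}$ ($d_j\in\mathbb{Z}$) such that $f-1$ lies in the ideal of $\operatorname{MT}(J_m)_K$ in $\mathcal{O}_T$. A finite set of equations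 $f_1,\dots,f_r$ defines $\operatorname{MT}(J_m)$ if $f_1-1,\dots,f_r-1$ generate this ideal. *)

(* Defs.v *)
From mathcomp Require Import all_boot all_order all_algebra.
From mathcomp Require Import complex.
From mathcomp Require Import all_classical all_reals all_analysis.
From mathcomp Require mpoly.

Set Implicit Arguments.
Unset Strict Implicit.
Unset Printing Implicit Defensive.

Import Order.TTheory GRing.Theory Num.Theory.
Import numFieldNormedType.Exports.

Local Open Scope classical_set_scope.
Local Open Scope ring_scope.
Local Open Scope complex_scope.

(* Kleene's total recursive functions: the closure of the initial functions
   under composition, primitive recursion and minimisation of regular
   functions. By the normal form theorem these are exactly the total
   functions computed by Turing machines. *)
Inductive recursive : forall n : nat, (n.-tuple nat -> nat) -> Prop :=
| rec_zero : recursive (fun _ : 0.-tuple nat => 0%N)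
| rec_succ : recursive (fun v : 1.-tuple nat => (thead v).+1)
| rec_proj n (i : 'I_n) : recursive (fun v : n.-tuple nat => tnth v i)
| rec_comp n k (f : k.-tuple nat -> nat) (h : 'I_k -> n.-tuple nat -> nat) :
    recursive f -> (forall i, recursive (h i)) ->
    recursive (fun v : n.-tuple nat => f [tuple h i v | i < k])
| rec_prim n (f : n.-tuple nat -> nat) (h : n.+2.-tuple nat -> nat) :
    recursive f -> recursive h ->
    recursive (fun v : n.+1.-tuple nat =>
      iteri (thead v) (fun y r => h [tuple of y :: r :: behead v])
            (f [tuple of behead v]))
| rec_mu n (f : n.+1.-tuple nat -> nat) (h : n.-tuple nat -> nat) :
    recursive f ->
    (forall v, f [tuple of h v :: v] = 0%N /\
               forall y, (y < h v)%N -> f [tuple of y :: v] <> 0%N) ->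
    recursive h.

Definition int_code (z : int) : nat :=
  match z with Posz k => k.*2 | Negz k => k.*2.+1 end.

(* [CodeSeq.code] is a (recursive) bijection from [seq nat] to [nat]. *)
Definition vectors_code n (s : seq 'rV[int]_n) : nat :=
  CodeSeq.code [seq CodeSeq.code [seq int_code (d 0 j) | j <- enum 'I_n]
               | d : 'rV[int]_n <- s].

Definition computable_vectors (n : nat -> nat)
    (F : forall m, seq 'rV[int]_(n m)) : Prop :=
  recursive (fun v : 1.-tuple nat => vectors_code (F (thead v))).

Section Jacobian.
Variables (R : realType) (m : nat).
Local Notation C := R[i].

(* For odd [m] the genus of the curve is [m./2] and [m.-1] is twice the genus. *)
Local Notation g := (m./2).
Local Notation n := (m.-1).

Definition zeta : C := cos (2 * pi / m%:R) +i* sin (2 * pi / m%:R).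

Definition cyclotomic_field : set C :=
  [set z | exists p : {poly rat}, z = (map_poly ratr p).[zeta]].

Definition re_part (f : R -> C) (t : R) : R := complex.Re (f t).
Definition im_part (f : R -> C) (t : R) : R := complex.Im (f t).

Definition cderive (f : R -> C) (t : R) : C :=
  derive1 (re_part f) t +i* derive1 (im_part f) t.

Definition C1 (f : R -> C) : Prop :=
  [/\ forall t : R, derivable (re_part f) t 1,
      forall t : R, derivable (im_part f) t 1,
      continuous (derive1 (re_part f)) & continuous (derive1 (im_part f))].

(* C^1 closed curves [R/Z -> X], [X] the affine curve [y^2 = x^m + 1]. For [m]
   odd the smooth projective model has a single further point, whose removal
   does not change the first homology; every class in [H_1(X, Z)] is the class
   of such a closed curve. *)
Definition loop (x y : R -> C) : Prop :=
  [/\ C1 x, C1 y, (forall t, x (t + 1) = x t /\ y (t + 1) = y t)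
    & forall t, y t ^+ 2 = x t ^+ m + 1].

(* The pullback of [dx / y]; where [y = 0], it is read in the local parameter
   [y], using [2 y dy = m x^(m-1) dx]. *)
Definition dx_over_y (x y : R -> C) (t : R) : C :=
  if y t == 0 then (2 * cderive y t) / (m%:R * x t ^+ m.-1)
  else cderive x t / y t.

Definition cintegral01 (f : R -> C) : C :=
  (\int[@lebesgue_measure R]_(t in `[0, 1]) re_part f t)%R +i*
  (\int[@lebesgue_measure R]_(t in `[0, 1]) im_part f t)%R.

(* The integrals along a loop of [x^j dx / y] for [0 <= j < g], the standard
   basis of the holomorphic differentials. *)
Definition period (x y : R -> C) : 'rV[C]_g :=
  \row_j cintegral01 (fun t => x t ^+ j * dx_over_y x y t).

(* [J_m(C) = H^0(Omega^1)^dual / H_1 = C^g / period_lattice]. *)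
Definition period_lattice : set 'rV[C]_g :=
  [set w | exists x y, loop x y /\ w = period x y].

(* The rows of [B] form a Z-basis of the period lattice and an R-basis of
   [C^g]. *)
Definition lattice_basis (B : 'M[C]_(n, g)) : Prop :=
  (forall w : 'rV[C]_g,
     exists! r : 'rV[R]_n, w = map_mx (real_complex R) r *m B) /\
  (forall w : 'rV[C]_g,
     period_lattice w <-> exists c : 'rV[int]_n, w = map_mx intr c *m B).

(* For a ring [A], [H^1(J_m(C), A) = Hom(period_lattice, A)] is identified with
   [A^n], a homomorphism [phi] being sent to the column of the values of [phi]
   on the rows of [B]. The columns of [P] are the eigenvectors [v_1, ..., v_n];
   as [i : 'I_n] starts at 0, column [i] is [v_(i+1)]. The automorphism
   [(x, y) |-> (zeta x, y)] acts on [phi] by composition with its action on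
   loops. *)
Definition eigenbasis (B : 'M[C]_(n, g)) (P : 'M[C]_n) : Prop :=
  (forall k i, cyclotomic_field (P k i)) /\
  forall i : 'I_n, col i P != 0 /\
    forall x y (c c' : 'rV[int]_n), loop x y ->
      period x y = map_mx intr c *m B ->
      period (fun t => zeta * x t) y = map_mx intr c' *m B ->
      map_mx intr c' *m col i P = zeta ^+ i.+1 *: (map_mx intr c *m col i P).

(* Algebraic subgroups over Q are given by their complex points; no information
   is lost since group schemes over a field of characteristic 0 are reduced. *)
Definition algebraic_subgroup_over_rat (G : set 'M[C]_n) : Prop :=
  (exists S : set (mpoly.mpoly (n * n) rat),
     G = [set M | M \in unitmx /\
           forall p, S p ->
             mpoly.mmap (@ratr C) (fun k => mxvec M 0 k) p = 0]) /\
  [/\ G 1%:M, (forall M N, G M -> G N -> G (M *m N))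
    & forall M, G M -> G (invmx M)].

(* [H] is the matrix of [h z] on [H^1(J_m(C), R) = Hom_R(C^g, R)], where
   [h z phi = phi \o ( *:%R z)]. The convention [h z^-1] for [h z] yields the
   same image. *)
Definition hodge_mx (B : 'M[C]_(n, g)) (z : C) (H : 'M[R]_n) : Prop :=
  z *: B = map_mx (real_complex R) H *m B.

Definition contains_hodge (B : 'M[C]_(n, g)) (G : set 'M[C]_n) : Prop :=
  forall z H, z != 0 -> hodge_mx B z H -> G (map_mx (real_complex R) H).

Definition mumford_tate (B : 'M[C]_(n, g)) : set 'M[C]_n :=
  \bigcap_(G in [set G | algebraic_subgroup_over_rat G /\ contains_hodge B G]) G.

Definition torus : set 'rV[C]_n := [set t | forall j, t 0 j != 0].

Definition monomial (d : 'rV[int]_n) (t : 'rV[C]_n) : C :=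
  \prod_j t 0 j ^ d 0 j.

(* The elements of [K[x_1^+-1, ..., x_n^+-1]], [K] the cyclotomic field, viewed
   as functions on the complex points of the torus. *)
Definition laurent (f : 'rV[C]_n -> C) : Prop :=
  exists s : seq (C * 'rV[int]_n),
    (forall u, u \in s -> cyclotomic_field u.1) /\
    forall t, torus t -> f t = \sum_(u <- s) u.1 * monomial u.2 t.

Definition mt_ideal (B : 'M[C]_(n, g)) (P : 'M[C]_n) (f : 'rV[C]_n -> C) :
    Prop :=
  laurent f /\
  forall t, torus t -> mumford_tate B (P *m diag_mx t *m invmx P) -> f t = 0.

Definition equation_for_MT (B : 'M[C]_(n, g)) (P : 'M[C]_n)
    (d : 'rV[int]_n) : Prop :=
  mt_ideal B P (fun t => monomial d t - 1).

Definition equations_define_MT (B : 'M[C]_(n, g)) (P : 'M[C]_n)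
    (s : seq 'rV[int]_n) : Prop :=
  (forall d, d \in s -> equation_for_MT B P d) /\
  forall f, mt_ideal B P f ->
    exists a : 'I_(size s) -> 'rV[C]_n -> C,
      (forall i, laurent (a i)) /\
      forall t, torus t ->
        f t = \sum_i a i t * (monomial (tnth (in_tuple s) i) t - 1).

End Jacobian.

(* Main.v *)
(* The rotation [(x, y) |-> (zeta x, y)] acts on the period lattice by an integer
   matrix [A] with eigenvalues [zeta, ..., zeta ^ (m - 1)] and eigenvectors
   [v_i], and [h z] acts on [v_i] by [z] for [i <= g] and by the conjugate of
   [z] for [i > g]. Hence a monomial [x ^ d] should be an equation if and only
   if, for every unit [u] mod [m], the [d_j] with [u j mod m] in [{1, ..., g}]
   have sum 0. These conditions suffice because the matrices commuting with [A]
   whose eigenvalues satisfy all conjugates of the equation form an algebraic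
   group over [Q] containing the image of [h]. They are necessary because
   rational polynomials vanishing on the image of [h] also vanish on its
   complexification and, the projections onto the eigenspaces of [A] being
   polynomials in [zeta] with rational matrix coefficients, on the Galois
   conjugates of the latter. The solutions [d] form a lattice generated by its
   vectors in an explicit box, which can be enumerated by a recursive function;
   and the ideal of a group of points of the torus is generated by the binomials
   [x ^ d - 1], [d] running through generators of the lattice of characters
   trivial on the group, because distinct characters are linearly independent. *)

Require Import Defs.
From HB Require Import structures.
From mathcomp Require Import all_boot all_order all_algebra all_field.
From mathcomp Require Import complex.
From mathcomp Require Import all_classical all_reals all_analysis.
From mathcomp Require mpoly.
From mathcomp Require Import ring lra zify.

Set Implicit Arguments.
Unset Strict Implicit.
Unset Printing Implicit Defensive.

Import Order.TTheory GRing.Theory Num.Theory.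
Import numFieldNormedType.Exports.
(* The notations of [mpoly] clash with those of the analysis library. *)
Import (canonicals, coercions) mpoly.

(** * Recursive functions *)

Section Recursion.
Local Open Scope nat_scope.

(* Functions of all sequences, so that no dependent tuple types occur in the
   function bodies; the variables are the entries [nth 0 s i]. *)
Definition recs n (f : seq nat -> nat) : Prop :=
  recursive (fun v : n.-tuple nat => f (val v)).

Lemma recursive_ext n (f g : n.-tuple nat -> nat) :
  f =1 g -> recursive f -> recursive g.
Proof. by move=> /funext ->. Qed.

Lemma recs_ext n f g : (forall s, size s = n -> f s = g s) -> recs n f -> recs n g.
Proof.
by move=> fg; apply: recursive_ext => v; apply: fg; rewrite size_tuple.
Qed.

Lemma recs_nth n i : i < n -> recs n (fun s => nth 0 s i).
Proof.
move=> lt_in; have := rec_proj (Ordinal lt_in).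
by apply: recursive_ext => v; rewrite (tnth_nth 0).
Qed.

Lemma recs_comp n k f (h : nat -> seq nat -> nat) :
  recs k f -> (forall i, i < k -> recs n (h i)) ->
  recs n (fun s => f (mkseq (h^~ s) k)).
Proof.
move=> rf rh.
have := rec_comp (h := fun (i : 'I_k) (v : n.-tuple nat) => h i (val v)) rf
  (fun i => rh i (ltn_ord i)).
apply: recursive_ext => v; congr f.
by rewrite /mkseq -val_enum_ord -map_comp.
Qed.

Lemma recs0 n : recs n (fun=> 0).
Proof.
have r0 : recs 0 (fun=> 0) by exact: rec_zero.
exact: (recs_comp (h := fun _ _ => 0) r0).
Qed.

Lemma recs_comp1 n (op : nat -> nat) f :
  recs 1 (fun s => op (nth 0 s 0)) -> recs n f -> recs n (fun s => op (f s)).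
Proof. by move=> rop rf; apply: (recs_comp (h := fun _ => f) rop). Qed.

Lemma recs_comp2 n (op : nat -> nat -> nat) f g :
  recs 2 (fun s => op (nth 0 s 0) (nth 0 s 1)) ->
  recs n f -> recs n g -> recs n (fun s => op (f s) (g s)).
Proof.
move=> rop rf rg.
by apply: (recs_comp (h := fun i => if i is 0 then f else g) rop) => -[|i].
Qed.

Lemma recsS n f : recs n f -> recs n (fun s => (f s).+1).
Proof.
apply: recs_comp1; have := rec_succ; apply: recursive_ext => v.
by rewrite /thead (tnth_nth 0).
Qed.

Lemma recs_const n c : recs n (fun=> c).
Proof. by elim: c => [|c IHc]; [exact: recs0 | exact: recsS]. Qed.

(** [rec_prim] reads the number of iterations off the head of its argument; composing it with [t]
    and the [n] projections allows any recursive bound. *)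
Lemma recs_iteri n t (f : seq nat -> nat) (h : nat -> nat -> seq nat -> nat) :
  recs n t -> recs n f ->
  recs n.+2 (fun s => h (nth 0 s 0) (nth 0 s 1) (drop 2 s)) ->
  recs n (fun s => iteri (t s) (fun y r => h y r s) (f s)).
Proof.
move=> rt rf rh.
have := rec_prim rf rh => /= rp.
have rp' : recs n.+1 (fun s => iteri (nth 0 s 0)
    (fun y r => h y r (behead s)) (f (behead s))).
  move: rp; apply: recursive_ext => v /=.
  rewrite /thead (tnth_nth 0) /=; apply: eq_iteri => y r /=.
  by rewrite drop0.
have := recs_comp (h := fun i s => if i is j.+1 then nth 0 s j else t s) rp'.
move=> /(_ n) rc; apply: recs_ext (rc _).
  move=> s sz_s /=.
  suff -> : [seq (if i is j.+1 then nth 0 s j else t s) | i <- iota 1 n] = s by [].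
  rewrite -[1]addn0 iotaDl -map_comp -[RHS](mkseq_nth 0) sz_s.
  exact: eq_map.
by case=> [|j]; rewrite ?ltnS // => /recs_nth.
Qed.

Lemma recs_add n f g : recs n f -> recs n g -> recs n (fun s => f s + g s).
Proof.
move=> rf rg; have := @recs_iteri n g f (fun _ r _ => r.+1) rg rf.
move=> /(_ (recsS (recs_nth (isT : 1 < n.+2)))); apply: recs_ext => s _.
by elim: (g s) => [|k IHk] /=; rewrite ?addn0 // IHk addnS.
Qed.

Lemma recs_mul n f g : recs n f -> recs n g -> recs n (fun s => f s * g s).
Proof.
apply: recs_comp2.
have := @recs_iteri 2 (fun s => nth 0 s 1) (fun=> 0)
  (fun _ r s => r + nth 0 s 0) (recs_nth (isT : 1 < 2)) (recs0 _).
have r1 : recs 4 (fun s => nth 0 s 1 + nth 0 (drop 2 s) 0).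
  apply: recs_add; first exact: recs_nth.
  by apply: recs_ext (recs_nth (isT : 2 < 4)) => s _; rewrite nth_drop.
move=> /(_ r1); apply: recs_ext => s _.
by elim: (nth 0 s 1) => [|k IHk] /=; rewrite ?muln0 // IHk mulnS addnC.
Qed.

Lemma recs_exp n f g : recs n f -> recs n g -> recs n (fun s => f s ^ g s).
Proof.
apply: recs_comp2.
have := @recs_iteri 2 (fun s => nth 0 s 1) (fun=> 1)
  (fun _ r s => r * nth 0 s 0) (recs_nth (isT : 1 < 2)) (recs_const _ _).
have r1 : recs 4 (fun s => nth 0 s 1 * nth 0 (drop 2 s) 0).
  apply: recs_mul; first exact: recs_nth.
  by apply: recs_ext (recs_nth (isT : 2 < 4)) => s _; rewrite nth_drop.
move=> /(_ r1); apply: recs_ext => s _.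
by elim: (nth 0 s 1) => [|k IHk] /=; rewrite ?muln0 // IHk expnS mulnC.
Qed.

Lemma recs_pred n f : recs n f -> recs n (fun s => (f s).-1).
Proof.
apply: (recs_comp1 (op := predn)).
have := @recs_iteri 1 (fun s => nth 0 s 0) (fun=> 0)
  (fun y _ _ => y) (recs_nth (isT : 0 < 1)) (recs_const _ _)
  (recs_nth (isT : 0 < 3)).
by apply: recs_ext => s _; case: (nth 0 s 0).
Qed.

Lemma recs_sub n f g : recs n f -> recs n g -> recs n (fun s => f s - g s).
Proof.
move=> rf rg; have := @recs_iteri n g f (fun _ r _ => r.-1) rg rf.
move=> /(_ (recs_pred (recs_nth (isT : 1 < n.+2)))); apply: recs_ext => s _.
by elim: (g s) => [|k IHk] /=; rewrite ?subn0 // IHk subnS.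
Qed.

Lemma recs_leq n f g : recs n f -> recs n g -> recs n (fun s => (f s <= g s) : nat).
Proof.
move=> rf rg; have := recs_sub (recs_const n 1) (recs_sub rf rg).
by apply: recs_ext => s _; rewrite -subn_eq0; case: (f s - g s).
Qed.

Lemma recs_eq n f g : recs n f -> recs n g -> recs n (fun s => (f s == g s) : nat).
Proof.
move=> rf rg; apply: recs_ext (recs_mul (recs_leq rf rg) (recs_leq rg rf)) => s _.
by rewrite eqn_leq mulnb.
Qed.

Lemma recs_if n (b : seq nat -> bool) f g :
  recs n (fun s => b s : nat) -> recs n f -> recs n g ->
  recs n (fun s => if b s then f s else g s).
Proof.
move=> rb rf rg.
apply: recs_ext (recs_add (recs_mul rb rf)
  (recs_mul (recs_sub (recs_const n 1) rb) rg)) => s _.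
by case: (b s); rewrite ?mul1n ?mul0n ?addn0 ?add0n.
Qed.

Lemma recs_shift n f : recs n f -> recs n.+1 (fun s => f (behead s)).
Proof.
move=> rf; apply: recs_ext (recs_comp (h := fun i s => nth 0 s i.+1) rf _).
  move=> s sz_s; congr f; rewrite -[RHS](mkseq_nth 0) size_behead sz_s.
  by apply: eq_map => i; rewrite nth_behead.
by move=> i lt_in; apply: recs_nth.
Qed.

(** In the step function of an iteration the entries 0 and 1 are the counter and the accumulator;
    this skips the accumulator for a body that depends on the counter and the parameters only. *)
Lemma recs_shift2 n (h : nat -> seq nat -> nat) :
  recs n.+1 (fun s => h (nth 0 s 0) (behead s)) ->
  recs n.+2 (fun s => h (nth 0 s 0) (drop 2 s)).
Proof.
move=> rh.
have := recs_comp (n := n.+2) (h := fun i s => if i is j.+1 then nth 0 s j.+2 else nth 0 s 0) rh.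
move=> rc; apply: recs_ext (rc _).
  move=> s sz_s /=; congr h; rewrite -[RHS](mkseq_nth 0) size_drop sz_s subn2 /=.
  rewrite -[1]addn0 iotaDl -map_comp.
  by apply: eq_map => i; rewrite nth_drop.
by case=> [|j] lt_j; apply: recs_nth.
Qed.

Lemma recs_sum n t (h : nat -> seq nat -> nat) :
  recs n t -> recs n.+1 (fun s => h (nth 0 s 0) (behead s)) ->
  recs n (fun s => \sum_(i < t s) h i s).
Proof.
move=> rt rh.
have := @recs_iteri n t (fun=> 0) (fun y r s => r + h y s) rt (recs0 n).
move=> /(_ (recs_add (recs_nth (isT : 1 < n.+2)) (recs_shift2 rh))).
apply: recs_ext => s _.
by elim: (t s) => [|k IHk] /=; rewrite ?big_ord0 // big_ord_recr /= IHk.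
Qed.

Lemma recs_div n f g : recs n f -> recs n g -> recs n (fun s => f s %/ g s).
Proof.
apply: recs_comp2.
(* The quotient of [x] by [d] counts the [i < x] with [i.+1 * d <= x]. The case [d = 0], where every
   [i] would count, is set apart to give 0. *)
have r1 : recs 2 (fun s => if 0 < nth 0 s 1 then \sum_(i < nth 0 s 0)
    (i.+1 * nth 0 s 1 <= nth 0 s 0) else 0).
  apply: recs_if; last exact: recs0.
    by apply: recs_leq; [exact: recs_const | exact: recs_nth].
  apply: (recs_sum (h := fun i s => (i.+1 * nth 0 s 1 <= nth 0 s 0) : nat)).
    exact: recs_nth.
  apply: recs_leq.
    apply: recs_mul; first by apply: recsS; exact: recs_nth.
    by apply: recs_ext (recs_nth (isT : 2 < 3)) => s _; rewrite nth_behead.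
  by apply: recs_ext (recs_nth (isT : 1 < 3)) => s _; rewrite nth_behead.
apply: recs_ext r1 => s _; move: (nth 0 s 0) (nth 0 s 1) => x d.
have [d_gt0|] := ltnP 0 d; last by rewrite leqn0 => /eqP ->; rewrite divn0.
under eq_bigr do rewrite -leq_divRL //.
rewrite -(big_mkord xpredT (fun i => (i < x %/ d) : nat)); have le_q : x %/ d <= x by exact: leq_div.
rewrite (big_cat_nat (n := x %/ d)) //= [X in _ + X]big1_seq ?addn0.
  rewrite (eq_big_nat _ _ (F2 := fun=> 1)); last by move=> i /andP[_ ->].
  by rewrite sum_nat_const_nat subn0 muln1.
by move=> i /andP[_]; rewrite mem_index_iota => /andP[le_i _]; rewrite ltnNge le_i.
Qed.

Lemma recs_mod n f g : recs n f -> recs n g -> recs n (fun s => f s %% g s).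
Proof.
move=> rf rg; apply: recs_ext (recs_sub rf (recs_mul (recs_div rf rg) rg)) => s _.
by rewrite {1}(divn_eq (f s) (g s)) addKn.
Qed.

End Recursion.

(** * The algorithm *)

Section Generators.
Local Open Scope nat_scope.

(* The bound of [int_span_coord_sum_ker], iterated over the [m * m] pairs
   [(u, v)] of [relation]. *)
Definition box_step m B := B + m * B * (B * (m.+1 * B) ^ (m * B)).
Definition box_bound m := iteri (m * m) (fun=> box_step m) 1.
Definition digit_base m := (box_bound m).*2.+1.

(* The vectors of the box are numbered by writing [c] in base [digit_base m],
   the digits being codes of integers. *)
Definition digit m c j := (c %/ digit_base m ^ (m.-2 - j)) %% digit_base m.

Definition int_decode x : int := if odd x then Negz x./2 else Posz x./2.

Lemma int_decodeK x : int_code (int_decode x) = x.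
Proof.
rewrite /int_decode; have := odd_double_half x.
by case: odd => /= E; rewrite -[RHS]E.
Qed.

Lemma int_codeK x : int_decode (int_code x) = x.
Proof.
case: x => k; rewrite /int_decode /= ?odd_double ?doubleK //=.
by rewrite uphalf_double.
Qed.

(* [j] stands for the eigenvalue [zeta ^+ j.+1]; the Hodge cocharacter is
   nontrivial on [v_1, ..., v_g], and [in_S m u] describes its conjugate under
   an automorphism of the cyclotomic field. *)
Definition in_S m u j := (u * j.+1) %% m <= m./2.

(** Recursive functions take values in [nat], so the vanishing of an integer sum is tested by
    comparing the sums of the positive and negative parts of its terms. *)
Definition pos_part x := if odd x then 0 else x./2.
Definition neg_part x := if odd x then (x./2).+1 else 0.

Lemma int_decodeE x : int_decode x = ((pos_part x)%:Z - (neg_part x)%:Z)%R.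
Proof.
by rewrite /int_decode /pos_part /neg_part; case: odd; rewrite ?subr0 // NegzE sub0r.
Qed.

(** The number [v] witnesses that [u] is invertible mod [m], so that running over all pairs
    enumerates the units by arithmetic alone. *)
Definition violation m c u v : nat :=
  if u * v %% m == 1 then
    (\sum_(j < m.-1) (if in_S m u j then pos_part (digit m c j) else 0) !=
     \sum_(j < m.-1) (if in_S m u j then neg_part (digit m c j) else 0)) : nat
  else 0.

Definition lin_ok m c : bool := \sum_(u < m) \sum_(v < m) violation m c u v == 0.

Definition vector_of m c : 'rV[int]_(m.-1) :=
  (\row_j int_decode (digit m c j))%R.

(** [CodeSeq.code] builds the code of a sequence from its last entry. The order is reversed so that
    an iteration with [c] increasing from 0 produces the code. *)
Definition generators m : seq 'rV[int]_(m.-1) :=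
  [seq vector_of m c | c <- rev (iota 0 (digit_base m ^ m.-1)) & lin_ok m c].

(** The code of [x :: s] is [2 ^ x * (2 * code s + 1)]; step [y] prepends the digit of index
    [m.-2 - y], starting from the last one. *)
Definition code_of m c :=
  iteri m.-1 (fun y r => 2 ^ digit m c (m.-2 - y) * (r + r).+1) 0.

Lemma code_ofE m c :
  CodeSeq.code [seq int_code (vector_of m c 0%R j) | j <- enum 'I_(m.-1)] =
  code_of m c.
Proof.
have -> : [seq int_code (vector_of m c 0%R j) | j <- enum 'I_(m.-1)] =
          [seq digit m c j | j <- iota 0 m.-1].
  rewrite -val_enum_ord -map_comp; apply: eq_map => j /=.
  by rewrite mxE int_decodeK.
(* Induction on the length [k] of a suffix of the digit sequence. *)
rewrite /code_of; suff H k : k <= m.-1 ->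
    CodeSeq.code [seq digit m c j | j <- iota (m.-1 - k) k] =
    iteri k (fun y r => 2 ^ digit m c (m.-2 - y) * (r + r).+1) 0.
  by have := H _ (leqnn _); rewrite subnn.
elim: k => [//|k IHk] lt_k /=.
rewrite -IHk ?(ltnW lt_k) // addnn.
suff -> : m.-1 - k = (m.-1 - k.+1).+1 by rewrite -[in m.-2 - k]predn_sub -subnS.
by rewrite subnSK.
Qed.

Lemma vectors_code_generators m :
  vectors_code (generators m) =
  iteri (digit_base m ^ m.-1)
    (fun c r => if lin_ok m c then 2 ^ code_of m c * (r + r).+1 else r) 0.
Proof.
rewrite /vectors_code /generators; elim: (_ ^ _) => [//|N IHN].
rewrite -[in iota _ _]addn1 iotaD rev_cat /= add0n -IHN.
case: (lin_ok m N) => //=.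
by rewrite code_ofE addnn.
Qed.

Lemma recs_odd n f : recs n f -> recs n (fun s => odd (f s) : nat).
Proof.
move=> rf; apply: recs_ext (recs_mod rf (recs_const n 2)) => s _.
by rewrite modn2.
Qed.

Lemma recs_half n f : recs n f -> recs n (fun s => (f s)./2).
Proof.
move=> rf; apply: recs_ext (recs_div rf (recs_const n 2)) => s _.
by rewrite divn2.
Qed.

Lemma recs_negb n (b : seq nat -> bool) :
  recs n (fun s => b s : nat) -> recs n (fun s => ~~ b s : nat).
Proof.
move=> rb; apply: recs_ext (recs_sub (recs_const n 1) rb) => s _.
by case: (b s).
Qed.

Lemma recs_pos_part n f : recs n f -> recs n (fun s => pos_part (f s)).
Proof.
by move=> rf; apply: recs_if; [exact: recs_odd|exact: recs0|exact: recs_half].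
Qed.

Lemma recs_neg_part n f : recs n f -> recs n (fun s => neg_part (f s)).
Proof.
move=> rf; apply: recs_if; [exact: recs_odd| |exact: recs0].
exact/recsS/recs_half.
Qed.

Lemma recs_box_bound n f : recs n f -> recs n (fun s => box_bound (f s)).
Proof.
apply: (recs_comp1 (op := box_bound)).
apply: (@recs_iteri 1 (fun s => nth 0 s 0 * nth 0 s 0) (fun=> 1)
  (fun _ B s => box_step (nth 0 s 0) B)).
- by apply: recs_mul; apply: recs_nth.
- exact: recs_const.
have r1 : recs 3 (fun s => nth 0 s 1) by exact: recs_nth.
have r2 : recs 3 (fun s => nth 0 (drop 2 s) 0).
  by apply: recs_ext (recs_nth (isT : 2 < 3)) => s _; rewrite nth_drop.
apply: (recs_add r1); apply: recs_mul; first exact: recs_mul.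
apply: (recs_mul r1); apply: recs_exp; last exact: recs_mul.
by apply: recs_mul => //; apply: recsS.
Qed.

Lemma recs_digit_base n f : recs n f -> recs n (fun s => digit_base (f s)).
Proof.
move=> /recs_box_bound rf; apply: recs_ext (recsS (recs_add rf rf)) => s _.
by rewrite addnn.
Qed.

Lemma recs_digit n f g h : recs n f -> recs n g -> recs n h ->
  recs n (fun s => digit (f s) (g s) (h s)).
Proof.
move=> rf rg rh; apply: recs_mod; last exact: recs_digit_base.
apply: (recs_div rg); apply: recs_exp; first exact: recs_digit_base.
by apply: recs_sub => //; do 2!apply: recs_pred.
Qed.

Lemma recs_in_S n f g h : recs n f -> recs n g -> recs n h ->
  recs n (fun s => in_S (f s) (g s) (h s) : nat).
Proof.
move=> rf rg rh; apply: recs_leq; last exact: recs_half.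
by apply: recs_mod => //; apply: recs_mul => //; apply: recsS.
Qed.

Lemma nth_iter_behead k i (s : seq nat) :
  nth 0 (iter k behead s) i = nth 0 s (k + i).
Proof. by elim: k i => [//|k IHk] i; rewrite /= nth_behead IHk addnS. Qed.

(** Each sum puts its index in front of the variables; [k] counts the sums entered since the
    variable was bound. *)
Lemma recs_iter_behead n k i :
  k + i < n -> recs n (fun s => nth 0 (iter k behead s) i).
Proof.
by move=> /recs_nth; apply: recs_ext => s _; rewrite nth_iter_behead.
Qed.

Lemma recs_part_sum n part f g h : recs n f -> recs n g -> recs n h ->
  (forall k a, recs k a -> recs k (fun s => part (a s))) ->
  recs n (fun s => \sum_(j < (f s).-1)
    (if in_S (f s) (h s) j then part (digit (f s) (g s) j) else 0)).
Proof.
move=> rf rg rh rpart.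
apply: (recs_sum (h := fun j s =>
    if in_S (f s) (h s) j then part (digit (f s) (g s) j) else 0)).
  exact: recs_pred.
have r0 : recs n.+1 (fun s => nth 0 s 0) by exact: recs_nth.
apply: recs_if; last exact: recs0.
  by apply: recs_in_S => //; exact: recs_shift.
by apply: rpart; apply: recs_digit => //; exact: recs_shift.
Qed.

Lemma recs_violation n f g h k : recs n f -> recs n g -> recs n h -> recs n k ->
  recs n (fun s => violation (f s) (g s) (h s) (k s)).
Proof.
move=> rf rg rh rk; apply: recs_if; last exact: recs0.
  apply: recs_eq; last exact: recs_const.
  by apply: recs_mod => //; exact: recs_mul.
apply: recs_negb; apply: recs_eq; apply: recs_part_sum => // ? ?.
  exact: recs_pos_part.
exact: recs_neg_part.
Qed.

Lemma recs_lin_ok n f g : recs n f -> recs n g ->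
  recs n (fun s => lin_ok (f s) (g s) : nat).
Proof.
apply: (recs_comp2 (op := fun m c => lin_ok m c : nat)).
apply: recs_eq; last exact: recs0.
apply: (recs_sum (h := fun u s => \sum_(v < nth 0 s 0)
    violation (nth 0 s 0) (nth 0 s 1) u v)); first exact: recs_nth.
apply: (recs_sum (t := fun s => nth 0 (behead s) 0) (h := fun v s =>
    violation (nth 0 (behead s) 0) (nth 0 (behead s) 1) (nth 0 s 0) v)).
  exact: (recs_iter_behead (k := 1)).
apply: recs_violation.
- exact: (recs_iter_behead (k := 2)).
- exact: (recs_iter_behead (k := 2)).
- exact: (recs_iter_behead (k := 1)).
- exact: (recs_iter_behead (k := 0)).
Qed.

Lemma recs_code_of n f g : recs n f -> recs n g ->
  recs n (fun s => code_of (f s) (g s)).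
Proof.
apply: (recs_comp2 (op := code_of)).
apply: (@recs_iteri 2 (fun s => (nth 0 s 0).-1) (fun=> 0) (fun y r s =>
  2 ^ digit (nth 0 s 0) (nth 0 s 1) ((nth 0 s 0).-2 - y) * (r + r).+1)).
- exact/recs_pred/recs_nth.
- exact: recs0.
have r0 : recs 4 (fun s => nth 0 s 0) by exact: recs_nth.
have r1 : recs 4 (fun s => nth 0 s 1) by exact: recs_nth.
have r2 : recs 4 (fun s => nth 0 (drop 2 s) 0).
  by apply: recs_ext (recs_nth (isT : 2 < 4)) => s _; rewrite nth_drop.
have r3 : recs 4 (fun s => nth 0 (drop 2 s) 1).
  by apply: recs_ext (recs_nth (isT : 3 < 4)) => s _; rewrite nth_drop.
apply: recs_mul; last exact/recsS/recs_add.
apply: (recs_exp (recs_const _ _)); apply: recs_digit => //.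
by apply: recs_sub => //; do 2!apply: recs_pred.
Qed.

Lemma computable_generators : computable_vectors generators.
Proof.
have r1 : recs 1 (fun s => iteri (digit_base (nth 0 s 0) ^ (nth 0 s 0).-1)
    (fun c r => if lin_ok (nth 0 s 0) c
      then 2 ^ code_of (nth 0 s 0) c * (r + r).+1 else r) 0).
  apply: (@recs_iteri 1 (fun s => digit_base (nth 0 s 0) ^ (nth 0 s 0).-1)
    (fun=> 0) (fun c r s => if lin_ok (nth 0 s 0) c
      then 2 ^ code_of (nth 0 s 0) c * (r + r).+1 else r)).
  - apply: recs_exp; last exact/recs_pred/recs_nth.
    exact/recs_digit_base/recs_nth.
  - exact: recs0.
  have r0 : recs 3 (fun s => nth 0 s 0) by exact: recs_nth.
  have r1 : recs 3 (fun s => nth 0 s 1) by exact: recs_nth.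
  have r2 : recs 3 (fun s => nth 0 (drop 2 s) 0).
    by apply: recs_ext (recs_nth (isT : 2 < 3)) => s _; rewrite nth_drop.
  apply: recs_if => //; first exact: recs_lin_ok.
  apply: recs_mul; last exact/recsS/recs_add.
  by apply: (recs_exp (recs_const _ _)); exact: recs_code_of.
apply: recursive_ext r1 => v.
by rewrite vectors_code_generators /thead (tnth_nth 0).
Qed.

End Generators.

(** * Integer vectors of bounded size *)

Section Lattices.
Local Open Scope ring_scope.

Inductive int_span (V : zmodType) (S : V -> Prop) : V -> Prop :=
| int_span0 : int_span S 0
| int_spanD x y : int_span S x -> int_span S y -> int_span S (x + y)
| int_spanN x : int_span S x -> int_span S (- x)
| int_span_in x : S x -> int_span S x.

Lemma int_span_sum (V : zmodType) (S : V -> Prop) (I : Type) (r : seq I)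
    (F : I -> V) :
  (forall i, int_span S (F i)) -> int_span S (\sum_(i <- r) F i).
Proof.
move=> FS; elim/big_ind: _ => // [|x y]; first exact: int_span0.
exact: int_spanD.
Qed.

Lemma int_span_sub (V : zmodType) (S S' : V -> Prop) x :
  (forall y, S y -> S' y) -> int_span S x -> int_span S' x.
Proof.
move=> SS'; elim=> [|y z _ Sy _ Sz|y _ Sy|y /SS' S'y].
- exact: int_span0.
- exact: int_spanD.
- exact: int_spanN.
- exact: int_span_in.
Qed.

Lemma int_spanMz (V : zmodType) (S : V -> Prop) x (k : int) :
  int_span S x -> int_span S (x *~ k).
Proof.
move=> Sx; suff Sk (n : nat) : int_span S (x *+ n).
  by case: k => n; [exact: Sk | rewrite NegzE mulrNz; apply/int_spanN/Sk].
by elim: n => [|n IHn]; rewrite ?mulr0n ?mulrS; [exact: int_span0|exact: int_spanD].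
Qed.

Variable n : nat.
Implicit Types (a : pred 'I_n) (d w v : 'rV[int]_n).

Definition coord_sum a d : int := \sum_j (if a j then d 0 j else 0).

Lemma coord_sum_is_zmod_morphism a : zmod_morphism (coord_sum a).
Proof.
move=> x y; rewrite /coord_sum -sumrB; apply: eq_bigr => j _; rewrite !mxE.
by case: (a j); rewrite ?subr0.
Qed.
HB.instance Definition _ a :=
  GRing.isZmodMorphism.Build 'rV[int]_n int (coord_sum a) (coord_sum_is_zmod_morphism a).

Definition in_box (B : nat) d := forall j, (`|d 0%R j| <= B)%N.

Lemma coord_sum_bound a B d : in_box B d -> (`|coord_sum a d| <= n * B)%N.
Proof.
move=> dB; rewrite /coord_sum -[n in (n * _)%N]card_ord -sum_nat_const.
elim/big_ind2: _ => // [x1 x2 y1 y2 le1 le2|j _]; first by lia.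
by case: (a j).
Qed.

Lemma coord_sumZ a (q : int) d : coord_sum a (q *: d) = q * coord_sum a d.
Proof.
rewrite /coord_sum mulr_sumr; apply: eq_bigr => j _; rewrite mxE.
by case: (a j); rewrite ?mulr0.
Qed.

Lemma in_boxB B C (q : int) w v : in_box B w -> in_box C v ->
  in_box (B + `|q| * C) (w - q *: v).
Proof.
move=> wB vC j; have := wB j; have := vC j; rewrite !mxE.
set x := v 0 j; set y := w 0 j => lex ley.
have : (`|q| * `|x| <= `|q| * C)%N by rewrite leq_mul2l lex orbT.
rewrite -abszM; lia.
Qed.

Lemma in_box_leq B C d : (B <= C)%N -> in_box B d -> in_box C d.
Proof. by move=> le dB j; exact: leq_trans (dB j) le. Qed.

(* Euclid's algorithm on the values of the form, keeping track of the size of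
   the vectors. *)
Lemma bounded_coord_sum_gcd (L : 'rV[int]_n -> Prop) a m B :
  (n <= m)%N -> (0 < B)%N -> L 0 ->
  (forall w v (q : int), L w -> L v -> L (w - q *: v)) ->
  exists v, [/\ L v, in_box (B * (m.+1 * B) ^ (m * B)) v &
    forall w, L w -> in_box B w ->
      exists2 q : int, (`|q| <= m * B)%N & coord_sum a w = q * coord_sum a v].
Proof.
move=> le_nm B_gt0 L0 LB.
have [all0|] := pselect (forall w, L w -> in_box B w -> coord_sum a w = 0).
  exists 0; split => // [j|w Lw wB]; first by rewrite mxE.
  by exists 0; rewrite // all0 // mul0r.
move=> /existsNP[w0 /not_implyP[Lw0 /not_implyP[w0B /eqP nz]]].
have fB w : in_box B w -> (`|coord_sum a w| <= m * B)%N.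
  by move=> /(coord_sum_bound a) le; apply: leq_trans le _; rewrite leq_mul2r le_nm orbT.
(* [k] bounds the absolute value of the form at [v], which drops at each division with remainder,
   while the box size [K] grows by a factor [m.+1 * B]. *)
suff step k K v : L v -> coord_sum a v != 0 -> (`|coord_sum a v| <= k)%N -> (0 < K)%N ->
    in_box K v -> exists v', [/\ L v', in_box (K * (m.+1 * B) ^ k) v' &
    forall w, L w -> in_box B w ->
      exists2 q : int, (`|q| <= m * B)%N & coord_sum a w = q * coord_sum a v'].
  by apply: (step (m * B)%N B w0) => //; exact: fB.
elim: k K v => [|k IHk] K v Lv nzv le_k K_gt0 vK.
  by move: le_k; rewrite leqn0 absz_eq0 (negPf nzv).
have [dvd_all|] := pselect (forall w, L w -> in_box B w -> (coord_sum a v %| coord_sum a w)%Z).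
  exists v; split => // [|w Lw wB].
    by apply: in_box_leq vK; rewrite leq_pmulr // expn_gt0 muln_gt0 B_gt0.
  exists (coord_sum a w %/ coord_sum a v)%Z; last by rewrite divzK // dvd_all.
  exact: leq_trans (lez_div _ _) (fB _ wB).
move=> /existsNP[w /not_implyP[Lw /not_implyP[wB ndvd]]].
(* The value at [v] does not divide that at [w], so the remainder vector [r] has a smaller nonzero
   value and replaces [v]. *)
set q := (coord_sum a w %/ coord_sum a v)%Z; pose r := w - q *: v.
have rE : coord_sum a r = (coord_sum a w %% coord_sum a v)%Z.
  by rewrite raddfB /= coord_sumZ; apply/eqP; rewrite subr_eq addrC -divz_eq.
have le_q : (`|q| <= m * B)%N by exact: leq_trans (lez_div _ _) (fB _ wB).
have [//||||//|v' [Lv' v'B dvd]] := IHk (m.+1 * B * K)%N r.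
- exact: LB.
- by rewrite rE; apply/eqP => /dvdz_mod0P.
- rewrite rE; have := ltz_mod (coord_sum a w) nzv; have := modz_ge0 (coord_sum a w) nzv.
  lia.
- by rewrite !muln_gt0 B_gt0.
- apply: in_box_leq (in_boxB q wB vK).
  rewrite -mulnA mulSn leq_add //; first by rewrite leq_pmulr.
  by rewrite mulnA leq_mul2r le_q orbT.
exists v'; split => //; apply: in_box_leq v'B.
by rewrite expnS mulnA [(K * _)%N]mulnC.
Qed.

(** Subtracting multiples of the vector [v] of [bounded_coord_sum_gcd] moves the small generators
    into the kernel, and the bounds on the multiples and on [v] add up to [box_step]. An element of
    [L] is a combination of moved generators plus some [q *: v]; on the kernel, the form vanishes at
    the latter. *)
Lemma int_span_coord_sum_ker (L : 'rV[int]_n -> Prop) a m B :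
  (n <= m)%N -> (0 < B)%N -> L 0 ->
  (forall w v (q : int), L w -> L v -> L (w - q *: v)) ->
  (forall d, L d -> int_span (fun w => L w /\ in_box B w) d) ->
  forall d, L d -> coord_sum a d = 0 ->
    int_span (fun w => (L w /\ coord_sum a w = 0) /\ in_box (box_step m B) w) d.
Proof.
move=> le_nm B_gt0 L0 LB spanB d Ld d0.
have [v [Lv vB dvd]] := bounded_coord_sum_gcd a le_nm B_gt0 L0 LB.
set S := fun w => _.
have [q dE spd] : exists2 q, coord_sum a d = q * coord_sum a v & int_span S (d - q *: v).
  elim: {Ld d0} (spanB d Ld) => [|x y _ [q xE Sx] _ [q' yE Sy]|x _ [q xE Sx]|w [Lw wB]].
  - by exists 0; rewrite ?raddf0 ?mul0r // scale0r subr0; exact: int_span0.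
  - exists (q + q'); first by rewrite raddfD /= xE yE mulrDl.
    by rewrite scalerDl opprD addrACA; exact: int_spanD.
  - exists (- q); first by rewrite raddfN /= xE mulNr.
    by rewrite scaleNr -opprD; exact: int_spanN.
  - have [q le_q wE] := dvd w Lw wB; exists q => //; apply: int_span_in.
    split; last first.
      apply: in_box_leq (in_boxB q wB vB).
      by rewrite /box_step leq_add2l leq_mul2r le_q orbT.
    by split; [exact: LB | rewrite raddfB /= coord_sumZ wE subrr].
(* Either [v] lies in the kernel and is itself one of the small vectors, or [q = 0]. *)
case: (eqVneq (coord_sum a v) 0) => [v0|nzv].
  have {}spd : int_span S d.
    have Sv : S v.
      split; first by [].
      apply: in_box_leq vB; rewrite /box_step.
      have [->|m_gt0] := posnP m; first by rewrite mul0n expn0 muln1 addn0.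
      by apply: leq_trans (leq_addl _ _); rewrite leq_pmull // muln_gt0 m_gt0.
    rewrite -[d](subrK (q *: v)); apply: int_spanD => //.
    rewrite -[q]intz scaler_int; apply: int_spanMz.
    exact: int_span_in.
  exact: spd.
move: dE; rewrite d0 => /esym/eqP; rewrite mulf_eq0 (negPf nzv) orbF => /eqP q0.
by move: spd; rewrite q0 scale0r subr0.
Qed.

(** The forms are imposed one at a time, starting from the standard basis vectors, which lie in the
    box of size 1. *)
Lemma int_span_coord_sums_ker (forms : seq (pred 'I_n)) m d : (n <= m)%N ->
  (forall i, (i < size forms)%N -> coord_sum (nth xpredT forms i) d = 0) ->
  int_span (fun w => (forall i, (i < size forms)%N -> coord_sum (nth xpredT forms i) w = 0) /\ in_box (iteri (size forms) (fun=> box_step m) 1) w) d.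
Proof.
move=> le_nm; elim/last_ind: forms d => [|forms a IHa] d /=.
  move=> _; rewrite (row_sum_delta d); apply: int_span_sum => j.
  rewrite -[d 0 j]intz scaler_int; apply: int_spanMz; apply: int_span_in.
  by split => // k; rewrite mxE; case: eqP => _; case: (_ == _).
set L := fun w => forall i, (i < size forms)%N -> coord_sum (nth xpredT forms i) w = 0.
have LE w : (forall i, (i < size (rcons forms a))%N ->
    coord_sum (nth xpredT (rcons forms a) i) w = 0) <-> L w /\ coord_sum a w = 0.
  rewrite size_rcons; split=> [Lw|[Lw aw] i].
    split=> [i lt_i|]; last by have := Lw _ (ltnSn _); rewrite nth_rcons ltnn eqxx.
    by have := Lw i (ltnW lt_i); rewrite nth_rcons lt_i.
  rewrite ltnS leq_eqVlt nth_rcons => /predU1P[->|lt_i].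
    by rewrite ltnn eqxx.
  by rewrite lt_i Lw.
move=> /LE[Ld ad].
set B := iteri (size forms) (fun=> box_step m) 1.
have B_gt0 : (0 < B)%N.
  by rewrite /B; elim: (size forms) => //= k IHk; rewrite /box_step addn_gt0 IHk.
apply: int_span_sub (int_span_coord_sum_ker le_nm B_gt0 _ _ IHa Ld ad).
- by move=> w [/LE Lw wB]; split=> //; rewrite size_rcons.
- by move=> i _; rewrite raddf0.
- by move=> w v q Lw Lv i lt_i; rewrite raddfB /= coord_sumZ Lw // Lv // mulr0 subr0.
Qed.

End Lattices.

(** * The lattice of exponent vectors and its generators *)

Section Relations.
Local Open Scope ring_scope.

(* A pair [(u, v)] with [u * v = 1 mod m] encodes a unit [u] mod [m]. *)
Definition relation m (d : 'rV[int]_(m.-1)) : Prop :=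
  forall u v, (u < m)%N -> (v < m)%N -> (u * v %% m = 1)%N ->
    coord_sum (fun j : 'I_(m.-1) => in_S m u j) d = 0.

Lemma lin_okP m c : reflect (relation (vector_of m c)) (lin_ok m c).
Proof.
have formE u : coord_sum (fun j : 'I_(m.-1) => in_S m u j) (vector_of m c) =
    (\sum_(j < m.-1) (if in_S m u j then pos_part (digit m c j) else 0))%N%:Z -
    (\sum_(j < m.-1) (if in_S m u j then neg_part (digit m c j) else 0))%N%:Z.
  rewrite /coord_sum -!natz !natr_sum -sumrB; apply: eq_bigr => j _.
  by rewrite mxE int_decodeE !natz; case: ifP => // _; rewrite subrr.
apply: (iffP idP) => [|rel].
  rewrite /lin_ok sum_nat_eq0 => /forallP ok u v lt_u lt_v uv.
  have := ok (Ordinal lt_u); rewrite sum_nat_eq0 => /forallP/(_ (Ordinal lt_v)) /=.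
  rewrite /violation /= uv eqxx eqb0 negbK => /eqP eq_sum.
  by rewrite formE eq_sum subrr.
rewrite /lin_ok sum_nat_eq0; apply/forallP => u; rewrite implyTb.
rewrite sum_nat_eq0; apply/forallP => v; rewrite implyTb /violation.
case: ifP => // /eqP uv; rewrite eqb0 negbK; have := rel u v (ltn_ord u) (ltn_ord v) uv.
by move/eqP; rewrite formE subr_eq0.
Qed.

Lemma generators_relation m d : d \in generators m -> relation d.
Proof. by case/mapP => c; rewrite mem_filter => /andP[/lin_okP rel _] ->. Qed.

Lemma exists_digits b n (x : nat -> nat) : (forall j, (j < n)%N -> (x j < b)%N) ->
  exists2 c, (c < b ^ n)%N &
    forall j, (j < n)%N -> ((c %/ b ^ (n.-1 - j)) %% b = x j)%N.
Proof.
elim: n => [|n IHn] xb; first by exists 0%N.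
have [j lt_j|c lt_c cE] := IHn; first by apply: xb; exact: ltnW.
have b_gt0 : (0 < b)%N by exact: leq_ltn_trans (leq0n _) (xb n (ltnSn n)).
exists (c * b + x n)%N => [|j].
  have := xb n (ltnSn n); rewrite expnSr; nia.
rewrite ltnS leq_eqVlt => /predU1P[->|lt_j] /=.
  by rewrite subnn expn0 divn1 modnMDl modn_small // xb.
have -> : (n - j = (n.-1 - j).+1)%N by lia.
rewrite expnS -(cE j lt_j) divnMA divnMDl // [(x n %/ b)%N]divn_small ?addn0 //.
exact: xb.
Qed.

Lemma mem_generators m d : relation d -> in_box (box_bound m) d -> d \in generators m.
Proof.
move=> rel dB.
have [j|c lt_c cE] := @exists_digits (digit_base m) m.-1
    (fun j => if insub j is Some i then int_code (d 0 i) else 0%N).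
  move=> lt_j; rewrite insubT /=; have := dB (Ordinal lt_j).
  rewrite /digit_base; case: (d 0 _) => k /=; lia.
have dE : d = vector_of m c.
  apply/rowP => j; rewrite mxE /digit.
  have := cE j (ltn_ord j); rewrite valK => ->.
  by rewrite int_codeK.
apply/mapP; exists c => //; rewrite mem_filter mem_rev mem_iota add0n lt_c !andbT.
by apply/lin_okP; rewrite -dE.
Qed.

Lemma int_span_generators m d :
  relation d -> int_span (fun w => w \in generators m) d.
Proof.
(* The index [i < m * m] encodes the pair [(i %/ m, i %% m)]. A pair that is not inverse mod [m]
   gives the empty set, hence the zero form, so there are exactly the [m * m] forms counted in
   [box_bound]. *)
pose S i : pred 'I_(m.-1) :=
  fun j => ((i %/ m) * (i %% m) %% m == 1)%N && in_S m (i %/ m) j.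
have nthS i : (i < m * m)%N -> nth xpredT (mkseq S (m * m)) i = S i.
  exact: nth_mkseq.
have relE w : relation w <->
    forall i, (i < m * m)%N -> coord_sum (nth xpredT (mkseq S (m * m)) i) w = 0.
  split=> [rel i lt_i|rel u v lt_u lt_v uv].
    have m_gt0 : (0 < m)%N by case: (m) lt_i.
    rewrite nthS // /S; case: eqP => [uv|_]; last by rewrite /coord_sum big1.
    by rewrite -[RHS](rel _ _ _ _ uv) ?ltn_mod ?ltn_divLR.
  have m_gt0 : (0 < m)%N by case: (m) lt_u.
  have lt_i : (u * m + v < m * m)%N by nia.
  have := rel _ lt_i; rewrite nthS // /S divnMDl // modnMDl [(v %% m)%N]modn_small //.
  by rewrite divn_small // addn0 uv eqxx.
have := @int_span_coord_sums_ker _ (mkseq S (m * m)) m d (leq_pred m).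
rewrite size_mkseq => span_d /relE/span_d; apply: int_span_sub => w [relw wB].
by apply: mem_generators => //; apply/relE.
Qed.

End Relations.

(** * Conjugate roots of unity *)

Section Conjugates.
Local Open Scope ring_scope.

Definition rat_Cyclotomic m : {poly rat} := map_poly intr 'Phi_m.

Lemma rat_Cyclotomic_monic m : rat_Cyclotomic m \is monic.
Proof. by rewrite monic_map ?Cyclotomic_monic. Qed.

Lemma size_rat_Cyclotomic m : size (rat_Cyclotomic m) = (totient m).+1.
Proof. by rewrite size_map_poly_id0 ?size_Cyclotomic // (monicP (Cyclotomic_monic m)) oner_eq0. Qed.

(** A nonconstant factor has a root in [algC]. This is a primitive [m]-th root of unity, whose
    minimal polynomial over the rationals is the cyclotomic polynomial. *)
Lemma rat_Cyclotomic_irreducible m (q : {poly rat}) : (0 < m)%N ->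
  q %| rat_Cyclotomic m -> size q != 1 -> rat_Cyclotomic m %| q.
Proof.
move=> m_gt0 q_dvd szq.
have [z0 z0P] := C_prim_root_exists m_gt0.
have ratE : map_poly (ratr : rat -> algC) (rat_Cyclotomic m) = cyclotomic z0 m.
  rewrite -(Cintr_Cyclotomic z0P) /rat_Cyclotomic -map_poly_comp.
  by apply: eq_map_poly => k /=; rewrite ratr_int.
have [x qx] : exists x : algC, root (map_poly ratr q) x.
  by apply/closed_rootP; rewrite size_map_poly.
have xP : m.-primitive_root x.
  rewrite -(root_cyclotomic z0P) -ratE.
  by apply: (root_dvdp (p := map_poly ratr q)); rewrite ?dvdp_map.
have [p [pE _] p_dvd] := minCpolyP x.
rewrite -(dvdp_map (ratr : {rmorphism rat -> algC})) /=.
move: qx; rewrite p_dvd -(dvdp_map (ratr : {rmorphism rat -> algC})) /= -pE.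
rewrite (minCpoly_cyclotomic xP) -(Cintr_Cyclotomic xP) => dvd_q.
suff -> : map_poly ratr (rat_Cyclotomic m) = map_poly intr 'Phi_m :> {poly algC} by [].
by rewrite ratE -(Cintr_Cyclotomic z0P).
Qed.

Variables (C : numFieldType) (m : nat) (z : C).
Hypothesis prim_z : m.-primitive_root z.

(** [X^m - 1] is the product of the cyclotomic polynomials of the divisors [d] of [m]. If [z] is a
    root of the [d]-th one, then [z ^+ d = 1] and [m] divides [d]. *)
Lemma root_rat_Cyclotomic : root (map_poly ratr (rat_Cyclotomic m)) z.
Proof.
have m_gt0 := prim_order_gt0 prim_z.
have ratE d : map_poly ratr (rat_Cyclotomic d) = map_poly intr 'Phi_d :> {poly C}.
  by rewrite /rat_Cyclotomic -map_poly_comp; apply: eq_map_poly => k /=; rewrite ratr_int.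
have prodE k : (0 < k)%N ->
    \prod_(d <- divisors k) map_poly intr 'Phi_d = 'X^k - 1 :> {poly C}.
  by move=> k_gt0; rewrite -rmorph_prod prod_Cyclotomic // rmorphB rmorph1 /= map_polyXn.
have : root ('X^m - 1) z by rewrite rootE !hornerE prim_expr_order // subrr.
rewrite -prodE // rootE horner_prod prodf_seq_eq0 => /hasP[d].
rewrite -dvdn_divisors // => dvd_d rd.
have d_gt0 : (0 < d)%N by exact: dvdn_gt0 dvd_d.
have : root ('X^d - 1) z.
  rewrite -prodE // rootE horner_prod prodf_seq_eq0; apply/hasP; exists d => //.
  by rewrite -dvdn_divisors.
rewrite rootE !hornerE subr_eq0 -(prim_order_dvd prim_z) => dvd_m.
rewrite ratE; suff -> : m = d by [].
by apply/eqP; rewrite eqn_dvd dvd_d dvd_m.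
Qed.

(** If [p] were coprime to the irreducible cyclotomic polynomial, a Bezout relation evaluated at the
    common root [z] would be contradictory. *)
Lemma root_map_ratr_dvd (p : {poly rat}) :
  root (map_poly ratr p) z -> rat_Cyclotomic m %| p.
Proof.
move=> pz; have m_gt0 := prim_order_gt0 prim_z.
apply: dvdp_trans (dvdp_gcdl p _).
apply: rat_Cyclotomic_irreducible (dvdp_gcdr _ _) _ => //.
apply/negP => cop; have /Bezout_coprimepP[[a b] /= ab] : coprimep p (rat_Cyclotomic m) by [].
have := ab; rewrite -(eqp_map (ratr : {rmorphism rat -> C})) /= rmorph1 => /eqp_root/(_ z).
rewrite rmorphD !rmorphM /= !rootE !hornerE.
rewrite (eqP pz) (eqP root_rat_Cyclotomic) !mulr0 addr0 eqxx => /esym.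
by rewrite oner_eq0.
Qed.

End Conjugates.

Section ConjugateRoots.
Local Open Scope ring_scope.

(** This plays the part of the Galois automorphism of the cyclotomic field that sends [z] to
    [z ^+ u]. *)
Lemma root_map_ratr_conj (C : numFieldType) m (z : C) (p : {poly rat}) u :
  m.-primitive_root z -> coprime u m ->
  root (map_poly ratr p) z -> root (map_poly ratr p) (z ^+ u).
Proof.
move=> prim_z co_um /(root_map_ratr_dvd prim_z) dvd.
apply: (root_dvdp (p := map_poly ratr (rat_Cyclotomic m))).
  by rewrite dvdp_map.
by apply: root_rat_Cyclotomic; rewrite prim_root_exp_coprime.
Qed.

End ConjugateRoots.

(** * Periods *)

Section RootOfUnity.
Local Open Scope ring_scope.
Local Open Scope complex_scope.
Variable R : realType.

Lemma expr_cos_sin (x : R) k :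
  (cos x +i* sin x) ^+ k = cos (x *+ k) +i* sin (x *+ k).
Proof.
elim: k => [|k IHk]; first by rewrite expr0 mulr0n cos0 sin0.
by rewrite exprS IHk mulrS cosD sinD [sin x * cos _ + _]addrC.
Qed.

Lemma cos_eq1_itv (x : R) : 0 < x < 2 * pi -> cos x != 1.
Proof.
move=> /andP[x_gt0 x_lt]; apply/eqP => cx.
have : 0 < sin (x / 2) by apply: sin_gt0_pi; lra.
have e : x = (x / 2) *+ 2 by rewrite -mulr_natr divfK ?pnatr_eq0.
move: cx; rewrite e cos_mulr2n cos2sin2 -e; set s := sin _ => cx s_gt0.
have : s ^+ 2 = 0 by move: cx; set q := s ^+ 2; lra.
by move/eqP; rewrite sqrf_eq0 gt_eqF.
Qed.

(** If the order [k] of [zeta] were smaller than [m], the angle [2 * pi * k / m] would lie strictly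
    between 0 and [2 * pi] and have cosine 1. *)
Lemma zeta_prim m : (0 < m)%N -> m.-primitive_root (zeta R m).
Proof.
move=> m_gt0; have m0 : 0 < m%:R :> R by rewrite ltr0n.
have zX : zeta R m ^+ m = 1.
  rewrite expr_cos_sin; have -> : (2 * pi / m%:R) *+ m = pi *+ 2 :> R.
    by rewrite -[LHS]mulr_natr divfK ?lt0r_neq0 // mulr_natl.
  by rewrite cos2pi sin2pi.
have [k prim_k] := prim_order_exists m_gt0 zX.
move=> dvd_k; suff mk : m = k by rewrite {1}mk.
apply/eqP; rewrite eqn_leq [(k <= m)%N]dvdn_leq // andbT leqNgt; apply/negP => lt_km.
have k_gt0 := prim_order_gt0 prim_k.
have := prim_expr_order prim_k; rewrite expr_cos_sin => /(congr1 (@complex.Re R)) /=.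
apply/eqP/cos_eq1_itv; rewrite -[X in 0 < X < _]mulr_natr.
have pi0 := pi_gt0 R.
have kk : 0 < k%:R :> R by rewrite ltr0n.
rewrite mulr_gt0 ?divr_gt0 ?mulr_gt0 //= mulrAC ltr_pdivrMr // ltr_pM2l ?mulr_gt0 //.
by rewrite ltr_nat.
Qed.
End RootOfUnity.

(** * Calculus of complex-valued functions of a real variable *)

Section ComplexFunctions.
Local Open Scope ring_scope.
Local Open Scope complex_scope.
Local Open Scope classical_set_scope.
Variable R : realType.
Local Notation C := R[i].
Local Notation Re := (@complex.Re R).
Local Notation Im := (@complex.Im R).
Implicit Types (f g x y : R -> C) (t : R).

Lemma ReD (a b : C) : Re (a + b) = Re a + Re b.
Proof. by case: a b => [a1 a2] [b1 b2]. Qed.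

Lemma ImD (a b : C) : Im (a + b) = Im a + Im b.
Proof. by case: a b => [a1 a2] [b1 b2]. Qed.

Lemma ReM (a b : C) : Re (a * b) = Re a * Re b - Im a * Im b.
Proof. by case: a b => [a1 a2] [b1 b2]. Qed.

Lemma ImM (a b : C) : Im (a * b) = Re a * Im b + Im a * Re b.
Proof. by case: a b => [a1 a2] [b1 b2]. Qed.

Lemma ReV (a : C) : Re a^-1 = Re a / (Re a ^+ 2 + Im a ^+ 2).
Proof. by case: a. Qed.

Lemma ImV (a : C) : Im a^-1 = - (Im a / (Re a ^+ 2 + Im a ^+ 2)).
Proof. by case: a. Qed.

Lemma complex_eqP (a b : C) : Re a = Re b -> Im a = Im b -> a = b.
Proof. by case: a b => [a1 a2] [b1 b2] /= -> ->. Qed.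

Lemma sqr_norm_neq0 (a : C) : (Re a ^+ 2 + Im a ^+ 2 == 0) = (a == 0).
Proof. by rewrite eq_complex paddr_eq0 ?sqr_ge0 // !sqrf_eq0. Qed.

(* Continuity and differentiability of the two real components, to match the
   definitions of [C1] and [cderive]. *)
Definition ccont f t :=
  {for t, continuous (re_part f)} /\ {for t, continuous (im_part f)}.

Lemma ccont_cst (c : C) t : ccont (fun=> c) t.
Proof. by split; apply: cvg_cst. Qed.

Lemma ccontM f g t : ccont f t -> ccont g t -> ccont (fun s => f s * g s) t.
Proof.
move=> [f1 f2] [g1 g2]; split.
  rewrite (_ : re_part _ = (re_part f \* re_part g) - (im_part f \* im_part g)).
    by apply: continuousB; exact: continuousM.
  by apply/funext => s; rewrite /re_part ReM.
rewrite (_ : im_part _ = (re_part f \* im_part g) + (im_part f \* re_part g)).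
  by apply: continuousD; exact: continuousM.
by apply/funext => s; rewrite /im_part ImM.
Qed.

Lemma ccontX f n t : ccont f t -> ccont (fun s => f s ^+ n) t.
Proof.
move=> cf; elim: n => [|n IHn]; first by under eq_fun do rewrite expr0; exact: ccont_cst.
by under eq_fun do rewrite exprS; exact: ccontM.
Qed.

Lemma continuous_sqr_norm f t : ccont f t ->
  {for t, continuous (fun s => Re (f s) ^+ 2 + Im (f s) ^+ 2)}.
Proof.
move=> [f1 f2].
rewrite (_ : (fun s => _) = (re_part f \* re_part f) + (im_part f \* im_part f)).
  by apply: continuousD; exact: continuousM.
by apply/funext => s; rewrite !expr2.
Qed.

Lemma ccontV f t : f t != 0 -> ccont f t -> ccont (fun s => (f s)^-1) t.
Proof.
move=> f0 cf; have n0 : Re (f t) ^+ 2 + Im (f t) ^+ 2 != 0 by rewrite sqr_norm_neq0.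
have cn := continuousV (s := fun s => Re (f s) ^+ 2 + Im (f s) ^+ 2) n0
  (continuous_sqr_norm cf).
case: cf => f1 f2; split.
  rewrite (_ : re_part _ = re_part f \* (fun s => (Re (f s) ^+ 2 + Im (f s) ^+ 2)^-1)).
    exact: continuousM.
  by apply/funext => s; rewrite /re_part ReV.
rewrite (_ : im_part _ =
    - (im_part f \* (fun s => (Re (f s) ^+ 2 + Im (f s) ^+ 2)^-1))).
  by apply: continuousN; exact: continuousM.
by apply/funext => s; rewrite /im_part ImV.
Qed.

Lemma ccont_near f g t : (\near t, f t = g t) -> ccont f t -> ccont g t.
Proof.
move=> fg [f1 f2]; have gt : g t = f t by rewrite (nbhs_singleton fg).
split; rewrite /prop_for /continuous_at /re_part /im_part gt.
  by apply: cvg_trans f1; apply: near_eq_cvg; near=> s; rewrite /re_part (near fg s).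
by apply: cvg_trans f2; apply: near_eq_cvg; near=> s; rewrite /im_part (near fg s).
Unshelve. all: by end_near. Qed.

Lemma ccont_neq0 f t : ccont f t -> f t != 0 -> \near t, f t != 0.
Proof.
move=> /continuous_sqr_norm cf f0.
have := cvgr_neq0 _ cf; rewrite sqr_norm_neq0 f0 => /(_ _ isT).
by apply: filterS => s; rewrite sqr_norm_neq0.
Qed.

Definition is_cder f t (d : C) :=
  is_derive t 1 (re_part f) (Re d) /\ is_derive t 1 (im_part f) (Im d).

Lemma is_cder_unique f t d e : is_cder f t d -> is_cder f t e -> d = e.
Proof.
move=> [/@derive_val d1 /@derive_val d2] [/@derive_val e1 /@derive_val e2].
by apply: complex_eqP; rewrite -?d1 -?d2.
Qed.

Lemma is_cder_cst (c : C) t : is_cder (fun=> c) t 0.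
Proof. by split; exact: is_derive_cst. Qed.

Lemma is_cderD f g t d e : is_cder f t d -> is_cder g t e ->
  is_cder (fun s => f s + g s) t (d + e).
Proof.
case: d e => [d1 d2] [e1 e2] [f1 f2] [g1 g2]; split.
  rewrite (_ : re_part _ = re_part f + re_part g); first exact: is_deriveD.
  by apply/funext => s; rewrite /re_part ReD.
rewrite (_ : im_part _ = im_part f + im_part g); first exact: is_deriveD.
by apply/funext => s; rewrite /im_part ImD.
Qed.

Lemma is_cderM f g t d e : is_cder f t d -> is_cder g t e ->
  is_cder (fun s => f s * g s) t (f t * e + g t * d).
Proof.
move=> [f1 f2] [g1 g2]; split.
  rewrite (_ : re_part _ = (re_part f * re_part g) - (im_part f * im_part g)).
    apply: is_derive_eq; rewrite /GRing.scale /= /re_part /im_part.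
    by case: (f t) (g t) (d) (e) => [? ?] [? ?] [? ?] [? ?] /=; lra.
  by apply/funext => s; rewrite /re_part ReM.
rewrite (_ : im_part _ = (re_part f * im_part g) + (im_part f * re_part g)).
  apply: is_derive_eq; rewrite /GRing.scale /= /re_part /im_part.
  by case: (f t) (g t) (d) (e) => [? ?] [? ?] [? ?] [? ?] /=; lra.
by apply/funext => s; rewrite /im_part ImM.
Qed.

Lemma is_cderX f n t d : is_cder f t d ->
  is_cder (fun s => f s ^+ n) t (n%:R * f t ^+ n.-1 * d).
Proof.
move=> fd; elim: n => [|n IHn].
  by under eq_fun do rewrite expr0; rewrite !mul0r; exact: is_cder_cst.
under eq_fun do rewrite exprS.
have := is_cderM fd IHn; congr is_cder.
case: n {IHn} => [|n] /=; first by rewrite mulr0n mulr1n !mul0r mulr0 add0r expr0 !mul1r.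
by rewrite [n.+2%:R]mulrSr exprS; ring.
Qed.

Lemma C1_is_cder f t : C1 f -> is_cder f t (cderive f t).
Proof.
move=> [f1 f2 _ _]; split; rewrite /= derive1E; exact: derivableP.
Qed.

Lemma C1_ccont f t : C1 f -> ccont f t.
Proof.
move=> [f1 f2 _ _]; split.
  by apply: differentiable_continuous; apply/derivable1_diffP; exact: f1.
by apply: differentiable_continuous; apply/derivable1_diffP; exact: f2.
Qed.

Lemma C1_ccont_cderive f t : C1 f -> ccont (cderive f) t.
Proof. by move=> [_ _ c1 c2]; split; [exact: c1 | exact: c2]. Qed.

Lemma cderiveZ (c : C) f t : C1 f -> cderive (fun s => c * f s) t = c * cderive f t.
Proof.
move=> /(C1_is_cder t) /(is_cderM (is_cder_cst c t)) [f1 f2].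
rewrite mulr0 addr0 in f1 f2.
by apply: complex_eqP; rewrite /= derive1E derive_val.
Qed.

Lemma C1Z (c : C) f : C1 f -> C1 (fun s => c * f s).
Proof.
move=> C1f; have cd t := is_cderM (is_cder_cst c t) (C1_is_cder t C1f).
split=> [t|t|t|t].
- by case: (cd t) => /@ex_derive.
- by case: (cd t) => _ /@ex_derive.
- rewrite (_ : derive1 _ = re_part (fun s => c * cderive f s)).
    by case: (ccontM (ccont_cst c t) (C1_ccont_cderive t C1f)).
  by apply/funext => s; rewrite /re_part -cderiveZ.
- rewrite (_ : derive1 _ = im_part (fun s => c * cderive f s)).
    by case: (ccontM (ccont_cst c t) (C1_ccont_cderive t C1f)).
  by apply/funext => s; rewrite /im_part -cderiveZ.
Qed.

Section Loops.
Variable m : nat.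

Lemma loop_derivative x y t : loop m x y ->
  2 * y t * cderive y t = m%:R * x t ^+ m.-1 * cderive x t.
Proof.
move=> [C1x C1y _ eq_xy].
have dy := is_cderX 2 (C1_is_cder t C1y).
have := is_cderD (is_cderX m (C1_is_cder t C1x)) (is_cder_cst 1 t).
rewrite addr0 -(_ : (fun s => y s ^+ 2) = (fun s => x s ^+ m + 1)); last exact/funext.
by move=> /(is_cder_unique dy).
Qed.

Hypothesis m_gt0 : (0 < m)%N.

Lemma loop_x_neq0 x y t : loop m x y -> y t = 0 -> x t != 0.
Proof.
move=> [_ _ _ /(_ t) e] y0; apply/eqP => x0; move/eqP: e.
by rewrite y0 x0 !expr0n /= (gtn_eqF m_gt0) mulr0n add0r eq_sym oner_eq0.
Qed.

(** For [y t <> 0] the two expressions of the form agree by the derivative of [y^2 = x^m + 1]. *)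
Lemma dx_over_yE x y t : loop m x y -> x t != 0 ->
  dx_over_y m x y t = (2 * cderive y t) / (m%:R * x t ^+ m.-1).
Proof.
move=> lxy x0; rewrite /dx_over_y; case: eqP => // /eqP y0.
have d0 : m%:R * x t ^+ m.-1 != 0 by rewrite mulf_neq0 ?expf_neq0 // pnatr_eq0 -lt0n.
apply: (mulIf d0); rewrite divfK //; apply: (mulIf y0).
by rewrite mulrAC divfK // [RHS]mulrAC (loop_derivative t lxy) mulrC.
Qed.

(* Near a zero of [y] one has [x <> 0], and the form is [2 dy / (m x^(m-1))]. *)
Lemma ccont_dx_over_y x y t : loop m x y -> ccont (dx_over_y m x y) t.
Proof.
move=> lxy; have [C1x C1y _ _] := lxy.
case: (eqVneq (y t) 0) => [y0|y0].
  have x0 := loop_x_neq0 lxy y0.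
  apply: (@ccont_near (fun s => (2 * cderive y s) * (m%:R * x s ^+ m.-1)^-1)).
    have := ccont_neq0 (C1_ccont t C1x) x0; apply: filterS => s xs0.
    by rewrite dx_over_yE.
  apply: ccontM; first by apply: ccontM; [exact: ccont_cst | exact: C1_ccont_cderive].
  apply: ccontV; first by rewrite mulf_neq0 ?expf_neq0 // pnatr_eq0 -lt0n.
  by apply: ccontM; [exact: ccont_cst | exact/ccontX/C1_ccont].
apply: (@ccont_near (fun s => cderive x s * (y s)^-1)).
  have := ccont_neq0 (C1_ccont t C1y) y0; apply: filterS => s /negPf ys0.
  by rewrite /dx_over_y ys0.
apply: ccontM; first exact: C1_ccont_cderive.
by apply: ccontV => //; exact: C1_ccont.
Qed.

(** The real and imaginary parts of [c * f] mix those of [f]; continuity makes each of them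
    integrable on the segment, so that the integrals split. *)
Lemma cintegral01Z (c : C) f : (forall t, ccont f t) ->
  cintegral01 (fun t => c * f t) = c * cintegral01 f.
Proof.
move=> cf.
have intZ (k : R) (h : R -> R) : (forall t, {for t, continuous h}) ->
    (@lebesgue_measure R).-integrable `[0, 1] (EFin \o (fun t => k * h t)).
  move=> ch; apply: continuous_compact_integrable; first exact: segment_compact.
  apply: continuous_in_subspaceT => t _.
  by apply: (@continuousM _ _ (fun=> k) h); [exact: cvg_cst | exact: ch].
have int (h : R -> R) : (forall t, {for t, continuous h}) ->
    (@lebesgue_measure R).-integrable `[0, 1] (EFin \o h).
  move=> ch; apply: continuous_compact_integrable; first exact: segment_compact.
  by apply: continuous_in_subspaceT => t _; exact: ch.
have cre t : {for t, continuous (re_part f)} by case: (cf t).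
have cim t : {for t, continuous (im_part f)} by case: (cf t).
apply: complex_eqP; rewrite ?ReM ?ImM /=.
  rewrite -!RintegralZl ?int // -RintegralB ?intZ //.
  by apply: eq_Rintegral => t _; rewrite /re_part ReM.
rewrite -!RintegralZl ?int // -RintegralD ?intZ //.
by apply: eq_Rintegral => t _; rewrite /im_part ImM.
Qed.

Lemma loop_rot x y z : z ^+ m = 1 -> loop m x y -> loop m (fun t => z * x t) y.
Proof.
move=> zm [C1x C1y per eq_xy]; split => //; first exact: C1Z.
  by move=> t; have [-> ->] := per t.
by move=> t; rewrite exprMn zm mul1r.
Qed.

Lemma dx_over_y_rot x y z t : z ^+ m = 1 -> loop m x y ->
  dx_over_y m (fun t => z * x t) y t = z * dx_over_y m x y t.
Proof.
move=> zm [C1x _ _ _]; rewrite /dx_over_y cderiveZ //; case: ifP => _; last by rewrite mulrA.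
have z0 : z != 0.
  by apply/eqP => z0; move/eqP: zm; rewrite z0 expr0n gtn_eqF // eq_sym oner_eq0.
(* Where [y = 0], the form is scaled by the inverse of [z ^+ m.-1], which is again [z]. *)
have zV : z = (z ^+ m.-1)^-1.
  by apply: (mulfI (expf_neq0 m.-1 z0)); rewrite mulfV ?expf_neq0 // -exprSr prednK.
by rewrite [in RHS]zV exprMn [m%:R * _]mulrCA invfM mulrCA.
Qed.

Lemma period_rot x y z : z ^+ m = 1 -> loop m x y ->
  period m (fun t => z * x t) y =
  \row_(j < m./2) (z ^+ j.+1 * period m x y 0 j).
Proof.
move=> zm lxy; apply/rowP => j.
rewrite [LHS]mxE [RHS]mxE [period m x y 0 j]mxE.
rewrite -cintegral01Z.
  congr cintegral01; apply/funext => t.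
  by rewrite dx_over_y_rot // exprMn exprS; ring.
move=> t; apply: ccontM; last exact: ccont_dx_over_y.
by apply: ccontX; case: lxy => C1x _ _ _; exact: C1_ccont.
Qed.

End Loops.
End ComplexFunctions.

(** * The rotation matrix and the Hodge structure *)

Section RootSums.
Local Open Scope ring_scope.

(** A geometric sum: orthogonality of the characters of the integers mod [m]. *)
Lemma sum_prim_root (F : fieldType) m (z : F) a : m.-primitive_root z ->
  \sum_(k < m) z ^+ (a * k) = if (m %| a)%N then m%:R else 0.
Proof.
move=> prim_z; under eq_bigr do rewrite exprM.
case: ifPn => [dvd|ndvd].
  have /eqP -> : z ^+ a == 1 by rewrite -(prim_order_dvd prim_z).
  rewrite (eq_bigr (fun=> 1)) => [|k _]; last exact: expr1n.
  by rewrite sumr_const card_ord.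
have z1 : z ^+ a - 1 != 0 by rewrite subr_eq0 -(prim_order_dvd prim_z).
apply: (mulfI z1); rewrite mulr0 -subrX1 exprAC.
by rewrite (prim_expr_order prim_z) expr1n subrr.
Qed.

End RootSums.

Section Eigenvectors.
Local Open Scope ring_scope.
Local Open Scope complex_scope.
Variables (R : realType) (m : nat) (B : 'M[R[i]]_(m.-1, m./2)) (P : 'M[R[i]]_(m.-1)).
Hypotheses (m_gt1 : (1 < m)%N) (m_odd : odd m).
Hypotheses (lattB : lattice_basis B) (eigP : eigenbasis B P).
Local Notation C := R[i].
Local Notation n := (m.-1).
Local Notation g := (m./2).
Local Notation z := (zeta R m).

Let m_gt0 : (0 < m)%N. Proof. exact: ltnW. Qed.
Let prim_z : m.-primitive_root z. Proof. exact: zeta_prim. Qed.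
Let z_neq0 : z != 0.
Proof.
apply/eqP => z0; have /eqP := prim_expr_order prim_z.
by rewrite z0 expr0n (gtn_eqF m_gt0) mulr0n eq_sym oner_eq0.
Qed.

Lemma half_odd : m = (g + g).+1.
Proof. by rewrite addnn -[LHS]odd_double_half m_odd. Qed.

(** The eigenvalues of the [k]-th power of the rotation on the [v_i]. *)
Definition zdiag k : 'rV[C]_n := \row_j z ^+ (j.+1 * k).

(** Row [k] of [B] is the period of a loop; row [k] of [A] consists of the integer coordinates of
    the period of the rotated loop. The first identity comes from [period_rot], the second from the
    definition of [eigenbasis]. *)
Lemma exists_rotation_mx : exists A : 'M[int]_n,
  (forall j : 'I_g, map_mx intr A *m col j B = z ^+ j.+1 *: col j B) /\
  map_mx intr A *m P = P *m diag_mx (zdiag 1).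
Proof.
have zm : z ^+ m = 1 by exact: prim_expr_order.
have exA k : exists c : 'rV[int]_n,
    (forall j : 'I_g, z ^+ j.+1 * B k j = (map_mx intr c *m B) 0 j) /\
    forall i : 'I_n, (map_mx intr c *m P) 0 i = z ^+ i.+1 * P k i.
  have dE (p : nat) (M : 'M[C]_(n, p)) : map_mx intr (delta_mx 0 k : 'rV[int]_n) *m M = row k M.
    by rewrite map_delta_mx -rowE.
  have /lattB.2[x [y [lxy Bk]]] : exists c : 'rV[int]_n, row k B = map_mx intr c *m B.
    by exists (delta_mx 0 k); rewrite dE.
  have lrot := loop_rot zm lxy.
  have /lattB.2[c cE] : period_lattice (period m (fun t => z * x t) y).
    exact: (ex_intro _ _ (ex_intro _ y (conj lrot erefl))).
  have rotE := period_rot m_gt0 zm lxy.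
  exists c; split=> [j|i].
    by rewrite -cE rotE mxE -Bk mxE.
  have [_ /(_ x y (delta_mx 0 k) c lxy)] := eigP.2 i.
  rewrite dE -Bk => /(_ erefl cE)/(congr1 (fun M : 'M[C]_1 => M ord0 ord0)).
  by rewrite {1}[col i P]colE mulmxA -colE mxE => ->; rewrite dE !mxE.
have [A AE] := choice exA.
exists (\matrix_(k < n) A k); split=> [j|].
  apply/colP => k; have := (AE k).1 j; rewrite !mxE => ->.
  by apply: eq_bigr => i _; rewrite !mxE.
apply/matrixP => k i; have := (AE k).2 i; rewrite mul_mx_diag !mxE muln1 mulrC => <-.
by apply: eq_bigr => l _; rewrite !mxE.
Qed.

Lemma prim_dvd_sum (j l : 'I_n) : (m %| (m - l.+1) + j.+1)%N = (j == l).
Proof.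
have lt_j := ltn_ord j; have lt_l := ltn_ord l.
apply/idP/eqP => [/dvdnP[q e]|->]; last by rewrite subnK //; lia.
apply: val_inj => /=; case: q e => [|[|q]]; rewrite ?mulSn; lia.
Qed.

(** The exponent [m - l.+1] stands for [-(l+1)]: up to the factor [m], this sum over the powers of
    [A] is the projection onto the eigenspace of index [l]. *)
Lemma sum_zdiag (j l : 'I_n) :
  \sum_(k < m) z ^+ ((m - l.+1) * k) * zdiag k 0 j = if j == l then m%:R else 0.
Proof.
under eq_bigr do rewrite mxE -exprD -mulnDl.
by rewrite (sum_prim_root _ prim_z) prim_dvd_sum.
Qed.

Section RotationMatrix.
Variable A : 'M[int]_n.
Hypotheses (AB : forall j : 'I_g, map_mx intr A *m col j B = z ^+ j.+1 *: col j B)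
  (AP : map_mx intr A *m P = P *m diag_mx (zdiag 1)).

Definition rot_pow k : 'M[int]_n := iter k (mulmx A) 1%:M.

Lemma rot_powP k : map_mx intr (rot_pow k) *m P = P *m diag_mx (zdiag k).
Proof.
elim: k => [|k IHk]; first by rewrite map_mx1 mul1mx (_ : diag_mx _ = 1%:M) ?mulmx1 //;
  apply/matrixP => i j; rewrite !mxE muln0.
rewrite map_mxM -mulmxA IHk mulmxA AP -mulmxA mulmx_diag; congr (_ *m diag_mx _).
by apply/rowP => j; rewrite !mxE -exprD muln1 mulnS.
Qed.

(** Given a linear relation between the columns of [P], applying the powers of [A] and summing with
    the weights of [sum_zdiag] isolates each term of the relation. *)
Lemma eigenbasis_unit : P \in unitmx.
Proof.
rewrite -unitmx_tr -row_free_unit -kermx_eq0; apply/rowV0P => v /sub_kermxP vP.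
have Pv : P *m v^T = 0 by apply: trmx_inj; rewrite trmx_mul trmxK vP trmx0.
apply/rowP => l; rewrite !mxE.
have /cV0Pn[r] := (eigP.2 l).1; rewrite mxE => Pr.
have vk k : \sum_j P r j * zdiag k 0 j * v 0 j = 0.
  have : (map_mx intr (rot_pow k) *m (P *m v^T)) r 0 = 0 by rewrite Pv mulmx0 mxE.
  rewrite mulmxA rot_powP mul_mx_diag mxE => e; rewrite -[RHS]e.
  by apply: eq_bigr => j _; rewrite !mxE.
have : \sum_(k < m) z ^+ ((m - l.+1) * k) * \sum_j P r j * zdiag k 0 j * v 0 j = 0.
  by rewrite big1 // => k _; rewrite vk mulr0.
under eq_bigr do rewrite mulr_sumr.
rewrite exchange_big /= (bigD1 l) //= [X in _ + X]big1 ?addr0 => [|j ne_jl].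
  under eq_bigr do rewrite mulrA mulrCA mulrAC.
  rewrite -mulr_sumr sum_zdiag eqxx => /eqP.
  by rewrite !mulf_eq0 pnatr_eq0 (negPf Pr) (gtn_eqF m_gt0) !orbF orFb => /eqP.
under eq_bigr do rewrite mulrA mulrCA mulrAC.
by rewrite -mulr_sumr sum_zdiag (negPf ne_jl) mulr0.
Qed.

Let Pu := eigenbasis_unit.

(** The eigenvalues of [A] are distinct, so its eigenspaces are lines. *)
Lemma rotation_eigenvector (b : 'cV[C]_n) (l : 'I_n) :
  map_mx intr A *m b = z ^+ l.+1 *: b -> b = (invmx P *m b) l 0 *: col l P.
Proof.
move=> Ab; set q := invmx P *m b.
have bE : b = P *m q by rewrite mulKVmx.
have q0 i : i != l -> q i 0 = 0.
  move=> ne_il; have : invmx P *m (map_mx intr A *m b) = z ^+ l.+1 *: q.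
    by rewrite Ab scalemxAr.
  rewrite {1}bE (mulmxA (map_mx intr A)) AP -mulmxA mulKmx // mul_diag_mx => /matrixP/(_ i 0).
  rewrite !mxE muln1 => /eqP; rewrite -subr_eq0 -mulrBl mulf_eq0 subr_eq0.
  rewrite (eq_prim_root_expr prim_z) => /orP[|/eqP //].
  have lt_i := ltn_ord i; have lt_l := ltn_ord l.
  rewrite !modn_small; try lia.
  by move=> /eqP[] /val_inj e; rewrite e eqxx in ne_il.
rewrite {1}bE; apply/colP => k; rewrite [LHS]mxE (bigD1 l) //= big1 => [|i /q0 ->].
  by rewrite addr0 [RHS]mxE [col _ _ _ _]mxE mulrC.
by rewrite mulr0.
Qed.

(** The complexified Hodge cocharacter at [(a, b)] in the eigenbasis; [h w] itself is the case
    [a = w], [b = conjc w]. *)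
Definition hodge_row (a b : C) : 'rV[C]_n := \row_(i < n) (if (i < g)%N then a else b).

Lemma col_lattice_neq0 (j : 'I_g) : col j B != 0.
Proof.
apply/eqP => Bj; have [r [e _]] := lattB.1 (delta_mx 0 j).
have : (map_mx (real_complex R) r *m col j B) 0 0 = 1.
  by rewrite colE mulmxA -e -colE !mxE !eqxx.
by rewrite Bj mulmx0 mxE => /eqP; rewrite eq_sym oner_eq0.
Qed.

Lemma map_conjc_real p q (M : 'M[R]_(p, q)) :
  map_mx conjc (map_mx (real_complex R) M) = map_mx (real_complex R) M.
Proof. by apply/matrixP => i j; rewrite !mxE /= oppr0. Qed.

Lemma map_conjc_int p q (M : 'M[int]_(p, q)) :
  map_mx (@conjc R) (map_mx intr M) = map_mx intr M.
Proof. by apply/matrixP => i j; rewrite !mxE rmorph_int. Qed.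

Lemma conjc_zeta_expr k : (k <= m)%N -> conjc (z ^+ k) = z ^+ (m - k).
Proof.
move=> le_km; apply: (mulfI (expf_neq0 k z_neq0)).
rewrite -exprD subnKC // (prim_expr_order prim_z) rmorphXn -exprMn.
rewrite (_ : z * conjc z = 1) ?expr1n //.
rewrite /zeta; apply: complex_eqP; rewrite ?ReM ?ImM /=.
  by rewrite mulrN opprK -!expr2 cos2Dsin2.
by rewrite mulrN mulrC addNr.
Qed.

(** Column [j] of [B] is an eigenvector of [A] for [z ^+ j.+1] and of [H] for [w]. As [A] and [H]
    are real, its conjugate is one for [z ^+ (m - j.+1)] and [conjc w]. These columns and their
    conjugates account for all eigenlines of [A]. *)
Lemma hodge_mxP (w : C) (H : 'M[R]_n) : hodge_mx B w H ->
  map_mx (real_complex R) H = P *m diag_mx (hodge_row w (conjc w)) *m invmx P.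
Proof.
move=> HB; set Hc := map_mx _ H.
suff HP : Hc *m P = P *m diag_mx (hodge_row w (conjc w)) by rewrite -HP mulmxK.
have eigH (b : 'cV[C]_n) (l : 'I_n) v : b != 0 -> map_mx intr A *m b = z ^+ l.+1 *: b ->
    Hc *m b = v *: b -> Hc *m col l P = v *: col l P.
  move=> nzb /rotation_eigenvector bE Hb; move: Hb nzb; rewrite bE.
  set q := (_ l 0); rewrite -scalemxAr scalerA mulrC -scalerA scaler_eq0 negb_or.
  by move=> e /andP[q0 _]; exact: (scalerI q0).
apply/matrixP => k l; rewrite mul_mx_diag !mxE.
have lt_l := ltn_ord l; have mE := half_odd.
have HBj (j : 'I_g) : Hc *m col j B = w *: col j B.
  by rewrite !colE mulmxA -HB scalemxAl.
suff /matrixP/(_ k 0) : Hc *m col l P = (if (l < g)%N then w else conjc w) *: col l P.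
  by rewrite !mxE mulrC => <-; apply: eq_bigr => i _; rewrite !mxE.
case: ifP => [lt_lg|ge_lg].
  exact: (eigH _ _ _ (col_lattice_neq0 (Ordinal lt_lg)) (AB (Ordinal lt_lg)) (HBj _)).
(* The index [j] is chosen with [l.+1 = m - j.+1]. *)
have lt_j : (n - l.+1 < g)%N by lia.
pose j := Ordinal lt_j.
apply: (eigH (map_mx conjc (col j B))).
- apply: contra (col_lattice_neq0 j) => /eqP Bj0; apply/eqP/colP => i.
  have /matrixP/(_ i 0) := Bj0; rewrite !mxE => /(congr1 conjc).
  by rewrite conjcK conjc0.
- have := congr1 (map_mx conjc) (AB j); rewrite map_mxM map_conjc_int => ->.
  rewrite map_mxZ; congr (_ *: _).
  have -> : l.+1 = (m - j.+1)%N by rewrite /=; lia.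
  by rewrite -conjc_zeta_expr //=; lia.
- have := congr1 (map_mx conjc) (HBj j); rewrite map_mxM map_conjc_real => ->.
  by rewrite map_mxZ.
Qed.

Lemma exists_hodge_mx (w : C) : exists H, hodge_mx B w H.
Proof.
have exH k : exists r : 'rV[R]_n, w *: row k B = map_mx (real_complex R) r *m B.
  by have [r [e _]] := lattB.1 (w *: row k B); exists r.
have [H HE] := choice exH; exists (\matrix_k H k).
apply/row_matrixP => k; rewrite row_mul -map_row rowK -HE.
by apply/rowP => j; rewrite !mxE.
Qed.

End RotationMatrix.
End Eigenvectors.

(** * Galois descent *)

Section RationalPolynomialMaps.
Local Open Scope ring_scope.
Variables (C : numFieldType) (n : nat).
Implicit Types (f g : 'M[C]_n -> C) (F G : 'M[C]_n -> {poly C}).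

Local Notation ev M p := (mpoly.mmap (@ratr C) (fun k => mxvec M 0 k) p).

Definition ratpoly f := exists p : mpoly.mpoly (n * n) rat, forall M, f M = ev M p.

Lemma ratpoly_ext f g : f =1 g -> ratpoly f -> ratpoly g.
Proof. by move=> fg [p fp]; exists p => M; rewrite -fg. Qed.

Lemma ratpoly_cst q : ratpoly (fun=> ratr q).
Proof. by exists (mpoly.mpolyC _ q) => M; rewrite mpoly.mmapC. Qed.

Lemma ratpoly0 : ratpoly (fun=> 0).
Proof. by apply: ratpoly_ext (ratpoly_cst 0) => M; rewrite rmorph0. Qed.

Lemma ratpoly_int (k : int) : ratpoly (fun=> k%:~R).
Proof. by apply: ratpoly_ext (ratpoly_cst k%:~R) => M; rewrite ratr_int. Qed.

Lemma ratpoly_entry i j : ratpoly (fun M => M i j).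
Proof.
exists (mpoly.mpolyX _ (mpoly.mnm1 (mxvec_index i j))) => M.
by rewrite mpoly.mmapX mpoly.mmap1U mxvecE.
Qed.

Lemma ratpolyD f g : ratpoly f -> ratpoly g -> ratpoly (fun M => f M + g M).
Proof.
by move=> [p fp] [q gq]; exists (p + q) => M; rewrite fp gq rmorphD.
Qed.

Lemma ratpolyM f g : ratpoly f -> ratpoly g -> ratpoly (fun M => f M * g M).
Proof.
by move=> [p fp] [q gq]; exists (p * q) => M; rewrite fp gq rmorphM.
Qed.

Lemma ratpoly_sum I (r : seq I) (h : I -> 'M[C]_n -> C) :
  (forall i, ratpoly (h i)) -> ratpoly (fun M => \sum_(i <- r) h i M).
Proof.
move=> hr; elim: r => [|i r IHr].
  by apply: ratpoly_ext ratpoly0 => M; rewrite big_nil.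
by apply: ratpoly_ext (ratpolyD (hr i) IHr) => M; rewrite big_cons.
Qed.

Lemma ratpolyB f g : ratpoly f -> ratpoly g -> ratpoly (fun M => f M - g M).
Proof.
move=> rf rg; apply: ratpoly_ext (ratpolyD rf (ratpolyM (ratpoly_int (-1)) rg)) => M.
by rewrite mulN1r.
Qed.

(** A polynomial in the matrix entries and one more variable, with rational coefficients; the extra
    variable stands for a root of unity. *)
Definition ratpolyX F := (exists N, forall M, (size (F M) <= N)%N) /\
  forall k, ratpoly (fun M => (F M)`_k).

Lemma ratpolyX_ext F G : F =1 G -> ratpolyX F -> ratpolyX G.
Proof.
move=> FG [[N szF] rF]; split; first by exists N => M; rewrite -FG.
by move=> k; apply: ratpoly_ext (rF k) => M; rewrite FG.
Qed.

Lemma ratpolyX_cst (p : {poly rat}) : ratpolyX (fun=> map_poly ratr p).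
Proof.
split; first by exists (size (map_poly (ratr : rat -> C) p)).
by move=> k; apply: ratpoly_ext (ratpoly_cst p`_k) => M; rewrite coef_map.
Qed.

Lemma ratpolyXC f : ratpoly f -> ratpolyX (fun M => (f M)%:P).
Proof.
move=> rf; split; first by exists 1%N => M; exact: size_polyC_leq1.
move=> [|k]; first by apply: ratpoly_ext rf => M; rewrite coefC.
by apply: ratpoly_ext ratpoly0 => M; rewrite coefC.
Qed.

Lemma ratpolyXD F G : ratpolyX F -> ratpolyX G -> ratpolyX (fun M => F M + G M).
Proof.
move=> [[N szF] rF] [[N' szG] rG]; split.
  exists (maxn N N') => M; apply: leq_trans (size_polyD _ _) _.
  by rewrite geq_max !leq_max szF szG orbT.
by move=> k; apply: ratpoly_ext (ratpolyD (rF k) (rG k)) => M; rewrite coefD.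
Qed.

Lemma ratpolyXM F G : ratpolyX F -> ratpolyX G -> ratpolyX (fun M => F M * G M).
Proof.
move=> [[N szF] rF] [[N' szG] rG]; split.
  exists (N + N')%N => M; apply: leq_trans (size_polyMleq _ _) _.
  by apply: leq_trans (leq_pred _) (leq_add _ _).
move=> k; have := ratpoly_sum (index_enum 'I_k.+1)
  (fun j : 'I_k.+1 => ratpolyM (rF j) (rG (k - j)%N)).
by apply: ratpoly_ext => M; rewrite coefM.
Qed.

Lemma ratpolyX_sum I (r : seq I) (h : I -> 'M[C]_n -> {poly C}) :
  (forall i, ratpolyX (h i)) -> ratpolyX (fun M => \sum_(i <- r) h i M).
Proof.
move=> hr; elim: r => [|i r IHr].
  by apply: ratpolyX_ext (ratpolyXC ratpoly0) => M; rewrite big_nil.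
by apply: ratpolyX_ext (ratpolyXD (hr i) IHr) => M; rewrite big_cons.
Qed.

Lemma ratpolyX1 : ratpolyX (fun=> 1).
Proof. by apply: ratpolyX_ext (ratpolyX_cst 1) => M; rewrite rmorph1. Qed.

Lemma ratpolyX_prod I (r : seq I) (h : I -> 'M[C]_n -> {poly C}) :
  (forall i, ratpolyX (h i)) -> ratpolyX (fun M => \prod_(i <- r) h i M).
Proof.
move=> hr; elim: r => [|i r IHr].
  by apply: ratpolyX_ext ratpolyX1 => M; rewrite big_nil.
by apply: ratpolyX_ext (ratpolyXM (hr i) IHr) => M; rewrite big_cons.
Qed.

Lemma ratpolyX_exp F k : ratpolyX F -> ratpolyX (fun M => F M ^+ k).
Proof.
move=> rF; elim: k => [|k IHk].
  by apply: ratpolyX_ext ratpolyX1 => M; rewrite expr0.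
by apply: ratpolyX_ext (ratpolyXM rF IHk) => M; rewrite exprS.
Qed.

Lemma ratpolyXB F G : ratpolyX F -> ratpolyX G -> ratpolyX (fun M => F M - G M).
Proof.
move=> rF rG.
apply: ratpolyX_ext (ratpolyXD rF (ratpolyXM (ratpolyX_cst (- 1)) rG)) => M.
by rewrite rmorphN rmorph1 mulN1r.
Qed.

Variables (m : nat) (z : C).
Hypothesis prim_z : m.-primitive_root z.

(** The remainder modulo the cyclotomic polynomial is a linear combination of the remainders of the
    powers of the variable, which are rational; the bound on the size makes it a fixed finite
    sum. *)
Lemma ratpolyX_rem F : ratpolyX F -> exists2 F', ratpolyX F' &
  forall M, (size (F' M) <= totient m)%N /\
    forall u, coprime u m -> (F' M).[z ^+ u] = (F M).[z ^+ u].
Proof.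
move=> [[N szF] rF]; pose r k : {poly rat} := 'X^k %% rat_Cyclotomic m.
exists (fun M => \sum_(k < N) (F M)`_k *: map_poly ratr (r k)).
  apply: ratpolyX_sum => k.
  apply: ratpolyX_ext (ratpolyXM (ratpolyXC (rF k)) (ratpolyX_cst (r k))) => M.
  by rewrite mul_polyC.
move=> M; split.
  apply/leq_sizeP => j le_j; rewrite coef_sum big1 // => k _.
  have sz_r : (size (r k) <= j)%N.
    apply: leq_trans le_j; rewrite -ltnS -size_rat_Cyclotomic ltn_modp.
    by rewrite monic_neq0 ?rat_Cyclotomic_monic.
  by rewrite coefZ [(map_poly _ _)`_j]nth_default ?mulr0 // size_map_poly.
move=> u co_um; rewrite horner_sum (horner_coef_wide _ (szF M)).
apply: eq_bigr => k _; rewrite hornerZ; congr (_ * _).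
have : map_poly ratr 'X^k = map_poly ratr ('X^k %/ rat_Cyclotomic m * rat_Cyclotomic m + r k) :> {poly C}.
  by rewrite -divp_eq.
rewrite map_polyXn rmorphD rmorphM /= => /(congr1 (horner^~ (z ^+ u))).
rewrite !hornerE => ->; have /rootP -> := root_map_ratr_conj prim_z co_um (root_rat_Cyclotomic prim_z).
by rewrite mulr0 add0r.
Qed.

(* Vanishing at all primitive roots is the vanishing of the coefficients of the
   remainder modulo the cyclotomic polynomial, which are rational polynomials. *)
Lemma ratpolyX_vanish F (G : 'M[C]_n -> Prop) : ratpolyX F ->
  (forall M u, G M -> coprime u m -> (F M).[z ^+ u] = 0) ->
  forall M0, (forall p, (forall M, G M -> ev M p = 0) -> ev M0 p = 0) ->
  forall u, coprime u m -> (F M0).[z ^+ u] = 0.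
Proof.
move=> /ratpolyX_rem[F' [_ rF'] F'P] FG M0 M0P u co_um.
rewrite -((F'P M0).2 u co_um); suff -> : F' M0 = 0 by rewrite horner0.
have F'G M : G M -> F' M = 0.
  (* [F' M] has size at most [totient m] and vanishes at [totient m] distinct primitive roots. *)
  move=> GM; apply: (@roots_geq_poly_eq0 _ _ [seq z ^+ k | k <- iota 0 m & coprime k m]).
  - apply/allP => x /mapP[k]; rewrite mem_filter => /andP[co_km _] ->.
    by apply/rootP; rewrite (F'P M).2 // FG.
  - rewrite map_inj_in_uniq ?filter_uniq ?iota_uniq // => i j.
    rewrite !mem_filter !mem_iota !add0n => /and3P[_ _ lt_i] /and3P[_ _ lt_j] /eqP.
    by rewrite (eq_prim_root_expr prim_z) !modn_small // => /eqP.
  - apply: leq_trans (F'P M).1 _; rewrite size_map size_filter totient_count_coprime.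
    rewrite -sum1_count [leqRHS]big_mkcond /= /index_iota subn0.
    by apply: leq_sum => k _; rewrite coprime_sym; case: coprime.
apply/polyP => k; rewrite coef0; have [p pE] := rF' k.
by rewrite pE; apply: M0P => M /F'G F'M; rewrite -pE F'M coef0.
Qed.

End RationalPolynomialMaps.

Section Curves.
Local Open Scope ring_scope.

(** Restricting [p] to a polynomial curve gives a polynomial in one variable over the field of the
    curve: the rationals for [galois_curve], [C] for [hodge_curve]. *)
Lemma mmap_curve (K C : numFieldType) (psi : {rmorphism K -> C}) N
    (e : 'I_N -> {poly K}) (p : mpoly.mpoly N rat) :
  exists q : {poly K}, forall x,
    mpoly.mmap (@ratr C) (fun k => (map_poly psi (e k)).[x]) p = (map_poly psi q).[x].
Proof.
exists (\sum_(mm <- mpoly.msupp p)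
  (ratr (mpoly.mcoeff mm p))%:P * \prod_(i < N) (e i) ^+ (mm i)) => x.
rewrite rmorph_sum /= horner_sum; apply: eq_bigr => mm _.
rewrite rmorphM /= hornerM map_polyC /= hornerC fmorph_rat; congr (_ * _).
rewrite rmorph_prod horner_prod; apply: eq_bigr => i _.
by rewrite rmorphXn /= horner_exp.
Qed.

End Curves.

(** * Equations for the Mumford-Tate group *)

Section Units.
Local Open Scope nat_scope.
Variable m : nat.

Lemma unit_mod_coprime u v : u * v %% m = 1 -> coprime u m.
Proof.
move=> uv; rewrite /coprime -dvdn1; have := divn_eq (u * v) m; rewrite uv => e.
rewrite -(dvdn_addr (m := u * v %/ m * m)) ?dvdn_mull ?dvdn_gcdr // -e.
by rewrite dvdn_mulr // dvdn_gcdl.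
Qed.

Lemma coprime_unit_mod w : 1 < m -> coprime w m ->
  exists2 v, v < m & w %% m * v %% m = 1.
Proof.
move=> m_gt1; have [->|w_gt0 co_wm] := posnP w.
  by rewrite /coprime gcd0n => /eqP m1; rewrite m1 in m_gt1.
case: (egcdnP m w_gt0) => kw km e _; rewrite (eqP co_wm) in e.
exists (kw %% m); first by rewrite ltn_mod ltnW.
by rewrite modnMm mulnC e modnMDl modn_small.
Qed.

(** Multiplication by [u] on the nonzero residues, shifted because the index [i] stands for
    [z ^+ i.+1]. For a unit [u] the default of [insubd] is never taken. *)
Definition sigma u (i : 'I_m.-1) : 'I_m.-1 := insubd i (u * i.+1 %% m).-1.

Lemma sigmaE u v (i : 'I_m.-1) : u * v %% m = 1 -> (sigma u i).+1 = u * i.+1 %% m.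
Proof.
move=> uv; have lt_i := ltn_ord i; have m_gt0 : 0 < m by lia.
have gt0 : 0 < u * i.+1 %% m.
  rewrite lt0n -[_ == 0]/(m %| u * i.+1) Gauss_dvdr; last first.
    by rewrite coprime_sym (unit_mod_coprime uv).
  by apply/negP => /dvdn_leq; lia.
have := ltn_pmod (u * i.+1) m_gt0; rewrite /sigma val_insubd; case: ifP => ?; lia.
Qed.

Lemma sub_unit_mod u v : u < m -> v < m -> u * v %% m = 1 ->
  [/\ m - u < m, m - v < m & (m - u) * (m - v) %% m = 1].
Proof.
move=> lt_u lt_v uv.
have u_gt0 : 0 < u by case: (u) uv => //; rewrite mul0n mod0n.
have v_gt0 : 0 < v by case: (v) uv => //; rewrite muln0 mod0n.
split; try lia.
have e : (u + v) * m + (m - u) * (m - v) = m * m + u * v by nia.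
by have := congr1 (modn^~ m) e; rewrite !modnMDl uv.
Qed.

(** Complex conjugation exchanges the two halves of the eigenvalues: for odd [m], exactly one of the
    residues [a] and [m - a] is at most [m./2]. *)
Lemma in_S_sub u v (j : 'I_m.-1) : odd m -> u < m -> u * v %% m = 1 ->
  in_S m (m - u) j = ~~ in_S m u j.
Proof.
move=> m_odd lt_u uv; rewrite /in_S.
have := sigmaE j uv; set a := u * j.+1 %% m => aE.
have lt_s := ltn_ord (sigma u j).
have -> : (m - u) * j.+1 %% m = m - a.
  have e : (u * j.+1 %/ m) * m + (m - u) * j.+1 = j * m + (m - a).
    have := divn_eq (u * j.+1) m; rewrite -/a; nia.
  have := congr1 (modn^~ m) e; rewrite !modnMDl [RHS]modn_small //; lia.
have := half_odd m_odd; lia.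
Qed.

End Units.

Section Monomials.
Local Open Scope ring_scope.
Local Open Scope complex_scope.
Variables (R : realType) (m : nat).
Local Notation C := R[i].
Implicit Types (d e : 'rV[int]_(m.-1)) (s t : 'rV[C]_(m.-1)).

Definition mulr_row s t : 'rV[C]_(m.-1) := \row_j (s 0 j * t 0 j).
Definition inv_row t : 'rV[C]_(m.-1) := \row_j (t 0 j)^-1.

Lemma torusM s t : torus s -> torus t -> torus (mulr_row s t).
Proof. by move=> sT tT j; rewrite mxE mulf_neq0. Qed.

Lemma torusV t : torus t -> torus (inv_row t).
Proof. by move=> tT j; rewrite mxE invr_eq0. Qed.

Lemma monomialMr d s t : monomial d (mulr_row s t) = monomial d s * monomial d t.
Proof.
by rewrite /monomial -big_split; apply: eq_bigr => j _; rewrite mxE expfzMl.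
Qed.

Lemma monomialVr d t : monomial d (inv_row t) = (monomial d t)^-1.
Proof.
rewrite /monomial -prodfV; apply: eq_bigr => j _.
by rewrite mxE exprz_inv -invr_expz.
Qed.

Lemma monomial_neq0 d t : torus t -> monomial d t != 0.
Proof. by move=> tT; apply/prodf_neq0 => j _; exact: expfz_neq0. Qed.

Lemma monomialD d e t : torus t -> monomial (d + e) t = monomial d t * monomial e t.
Proof.
move=> tT; rewrite /monomial -big_split; apply: eq_bigr => j _.
by rewrite mxE expfzDr.
Qed.

Lemma monomial0 t : monomial 0 t = 1.
Proof. by rewrite /monomial big1 // => j _; rewrite mxE expr0z. Qed.

Lemma monomialN d t : torus t -> monomial (- d) t = (monomial d t)^-1.
Proof.
move=> tT; apply: (mulfI (monomial_neq0 d tT)).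
by rewrite mulfV ?monomial_neq0 // -monomialD // subrr monomial0.
Qed.

Lemma exprz_sum (a : C) I (r : seq I) (F : I -> int) : a != 0 ->
  a ^ (\sum_(i <- r) F i) = \prod_(i <- r) a ^ F i.
Proof.
by move=> a0; elim: r => [|i r IHr]; rewrite ?big_nil ?expr0z // !big_cons expfzDr ?IHr.
Qed.

Lemma monomial_two_values (a b : C) (S : pred 'I_(m.-1)) d : a != 0 -> b != 0 ->
  monomial d (\row_j (if S j then a else b)) =
  a ^ coord_sum S d * b ^ coord_sum (predC S) d.
Proof.
move=> a0 b0; rewrite /monomial /coord_sum.
rewrite !exprz_sum // -big_split.
by apply: eq_bigr => j _; rewrite mxE /=; case: (S j); rewrite expr0z ?mulr1 ?mul1r.
Qed.

Definition pos_exp (k : int) := if k is Posz j then j else 0%N.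
Definition neg_exp (k : int) := if k is Negz j then j.+1 else 0%N.

(** Clearing denominators turns the Laurent equation into a polynomial one. *)
Lemma monomial_eq1 d t : torus t ->
  (\prod_j t 0 j ^+ pos_exp (d 0 j) - \prod_j t 0 j ^+ neg_exp (d 0 j) == 0) =
  (monomial d t == 1).
Proof.
move=> tT; have nz : \prod_j t 0 j ^+ neg_exp (d 0 j) != 0.
  by apply/prodf_neq0 => j _; exact: expf_neq0.
rewrite subr_eq0 -(inj_eq (mulIf (invr_neq0 nz))) mulfV //; congr (_ == _).
rewrite /monomial -prodfV -big_split; apply: eq_bigr => j _ /=.
by case: (d 0 j) => k /=; rewrite ?expr0 ?invr1 ?mulr1 ?mul1r.
Qed.

End Monomials.

Section MumfordTate.
Local Open Scope ring_scope.
Local Open Scope complex_scope.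
Local Open Scope classical_set_scope.
Variables (R : realType) (m : nat) (B : 'M[R[i]]_(m.-1, m./2)) (P : 'M[R[i]]_(m.-1)).
Hypotheses (m_gt1 : (1 < m)%N) (m_odd : odd m).
Hypotheses (lattB : lattice_basis B) (eigP : eigenbasis B P).
Local Notation C := R[i].
Local Notation n := (m.-1).
Local Notation g := (m./2).
Local Notation z := (zeta R m).
Variable A : 'M[int]_n.
Hypotheses (AB : forall j : 'I_g, map_mx intr A *m col j B = z ^+ j.+1 *: col j B)
  (AP : map_mx intr A *m P = P *m diag_mx (zdiag R m 1)).
Local Notation Apow k := (map_mx intr (rot_pow A k) : 'M[C]_n).
Local Notation ev M p := (mpoly.mmap (@ratr C) (fun k => mxvec M 0 k) p).

Let m_gt0 : (0 < m)%N. Proof. exact: ltnW. Qed.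
Let prim_z : m.-primitive_root z. Proof. exact: zeta_prim. Qed.
Let Pu : P \in unitmx. Proof. exact (eigenbasis_unit m_gt1 m_odd eigP AP). Qed.
Let m_neq0 : m%:R != 0 :> C. Proof. by rewrite pnatr_eq0 -lt0n. Qed.

Definition torus_mx (t : 'rV[C]_n) : 'M[C]_n := P *m diag_mx t *m invmx P.

Lemma torus_mx_inj : injective torus_mx.
Proof.
move=> s t /(congr1 (fun M => invmx P *m (M *m P))).
rewrite /torus_mx !mulmxKV // !mulKmx // => /matrixP e.
by apply/rowP => j; have := e j j; rewrite !mxE eqxx !mulr1n.
Qed.

Lemma torus_mxM s t : torus_mx s *m torus_mx t = torus_mx (mulr_row s t).
Proof.
rewrite /torus_mx !mulmxA mulmxKV // -(mulmxA P) mulmx_diag.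
by congr (_ *m diag_mx _ *m _); apply/rowP => j; rewrite !mxE.
Qed.

Lemma torus_mx1 : torus_mx (const_mx 1) = 1%:M.
Proof. by rewrite /torus_mx diag_const_mx mulmx1 mulmxV. Qed.

Lemma mulr_rowV (t : 'rV[C]_n) : torus t -> mulr_row (inv_row t) t = const_mx 1.
Proof. by move=> tT; apply/rowP => j; rewrite !mxE mulVf. Qed.

Lemma torus_mx_unit (t : 'rV[C]_n) : torus t -> torus_mx t \in unitmx.
Proof.
move=> tT; have e : torus_mx (inv_row t) *m torus_mx t = 1%:M.
  by rewrite torus_mxM mulr_rowV // torus_mx1.
by case/mulmx1_unit: e.
Qed.

Lemma invmx_torus_mx (t : 'rV[C]_n) : torus t -> invmx (torus_mx t) = torus_mx (inv_row t).
Proof.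
move=> tT; have uM := torus_mx_unit tT.
rewrite -[LHS]mul1mx -torus_mx1 -(mulr_rowV tT) -torus_mxM mulmxK //.
Qed.

Lemma rot_powE k : Apow k = torus_mx (zdiag R m k).
Proof. by rewrite /torus_mx -(rot_powP AP) mulmxK. Qed.

Lemma torus_mx_trace t : \tr (torus_mx t) = \sum_j t 0 j.
Proof. by rewrite /torus_mx mxtrace_mulC mulmxA mulVmx // mul1mx mxtrace_diag. Qed.

Lemma zeta_expr_sub j : (j <= m)%N -> z ^+ (m - j) = z ^+ (j * m.-1).
Proof.
move=> le_j; have zj : z ^+ j != 0.
  rewrite expf_neq0 //; apply/eqP => z0; have /eqP := prim_expr_order prim_z.
  by rewrite z0 expr0n (gtn_eqF m_gt0) mulr0n eq_sym oner_eq0.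
apply: (mulfI zj); rewrite -!exprD subnKC // -mulnS prednK // mulnC exprM.
by rewrite (prim_expr_order prim_z) expr1n.
Qed.

(* The eigenvalues [t 0 i] of [M = torus_mx t] are traces of the matrices
   [M *m A ^ k] against powers of [z]; replacing [z] by the variable of a
   polynomial gives polynomials with rational coefficients in the entries of [M]. *)
Definition eigenvalue_poly (i : 'I_n) (M : 'M[C]_n) : {poly C} :=
  \sum_(k < m) (m%:R^-1 * \tr (M *m Apow (m.-1 * k)))%:P * 'X^(i.+1 * k).

Lemma ratpolyX_eigenvalue_poly i : ratpolyX (eigenvalue_poly i).
Proof.
apply: ratpolyX_sum => k; apply: ratpolyXM; last first.
  by apply: ratpolyX_ext (ratpolyX_cst _ _ 'X^(i.+1 * k)) => M; rewrite map_polyXn.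
apply: ratpolyXC; apply: ratpolyM.
  by apply: ratpoly_ext (ratpoly_cst _ _ m%:R^-1) => M; rewrite fmorphV rmorph_nat.
have rs := ratpoly_sum (index_enum 'I_n) (fun r => ratpoly_sum (index_enum 'I_n)
  (fun s => ratpolyM (@ratpoly_entry C n r s)
                     (ratpoly_int C n (rot_pow A (m.-1 * k) s r)))).
apply: ratpoly_ext rs => M; apply: eq_bigr => r _; rewrite mxE.
by apply: eq_bigr => s _; rewrite mxE.
Qed.

(** The trace of [M] times the inverse of [A ^ k] is the sum of the [t 0 j * z ^ (-(j+1) * k)];
    summing against the powers of [z ^+ (u * i.+1)] isolates [j = sigma u i]. *)
Lemma eigenvalue_polyP i t u v : (u * v %% m = 1)%N ->
  (eigenvalue_poly i (torus_mx t)).[z ^+ u] = t 0 (sigma u i).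
Proof.
move=> uv; rewrite horner_sum.
have sE := sigmaE i uv.
transitivity (\sum_j m%:R^-1 * t 0 j *
    \sum_(k < m) z ^+ ((m - j.+1) * k) * zdiag R m k 0 (sigma u i)).
  under [RHS]eq_bigr do rewrite mulr_sumr.
  rewrite exchange_big; apply: eq_bigr => k _ /=.
  rewrite !hornerE rot_powE torus_mxM torus_mx_trace mulr_sumr mulr_suml.
  apply: eq_bigr => j _; rewrite !mxE -!mulrA; congr (_ * (_ * _)).
  rewrite sE mulnA [X in _ = X * _]exprM [X in _ = _ * X]exprM (prim_expr_mod prim_z).
  have le_j : (j.+1 <= m)%N by have := ltn_ord j; lia.
  by congr (_ * _); [rewrite exprM zeta_expr_sub | rewrite -!exprM mulnA].
rewrite (bigD1 (sigma u i)) //= [X in _ + X]big1 ?addr0 => [|j ne_j].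
  by rewrite (sum_zdiag R m_gt1 m_odd) // eqxx mulrAC mulVf ?mul1r.
by rewrite (sum_zdiag R m_gt1 m_odd) // eq_sym (negPf ne_j) mulr0.
Qed.

Definition twist u (t : 'rV[C]_n) : 'rV[C]_n := \row_i t 0 (sigma u i).

Lemma twist_torus u (t : 'rV[C]_n) : torus t -> torus (twist u t).
Proof. by move=> tT j; rewrite mxE. Qed.

Section Relation.
Variable d : 'rV[int]_n.

(* The subtorus cut out by the Galois conjugates of the equation [d]. *)
Definition conjugate_torus : set 'M[C]_n :=
  [set M | exists t, [/\ torus t, M = torus_mx t & forall u v, (u < m)%N ->
    (v < m)%N -> (u * v %% m = 1)%N -> monomial d (twist u t) = 1]].

(** The equation [x ^ d = 1] with denominators cleared and eigenvalues written as polynomials; its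
    value at [z ^+ u] is the conjugate equation. *)
Definition relation_poly (M : 'M[C]_n) : {poly C} :=
  \prod_i eigenvalue_poly i M ^+ pos_exp (d 0 i) -
  \prod_i eigenvalue_poly i M ^+ neg_exp (d 0 i).

Lemma ratpolyX_relation_poly : ratpolyX relation_poly.
Proof.
by apply: ratpolyXB; apply: ratpolyX_prod => i; apply: ratpolyX_exp;
  exact: ratpolyX_eigenvalue_poly.
Qed.

Lemma relation_polyP (t : 'rV[C]_n) u v : torus t -> (u * v %% m = 1)%N ->
  (relation_poly (torus_mx t)).[z ^+ u] = 0 <-> monomial d (twist u t) = 1.
Proof.
move=> tT uv; rewrite !hornerE !horner_prod.
have e i : t 0 (sigma u i) = twist u t 0 i by rewrite mxE.
under eq_bigr do rewrite horner_exp (eigenvalue_polyP _ _ uv) e.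
under [X in _ - X]eq_bigr do rewrite horner_exp (eigenvalue_polyP _ _ uv) e.
split=> [/eqP|/eqP]; first by rewrite monomial_eq1 => [/eqP|]; last exact: twist_torus.
by rewrite -monomial_eq1 => [/eqP|]; last exact: twist_torus.
Qed.

(** A matrix commuting with [A] preserves its eigenlines, so it is diagonal in the basis [P]. *)
Lemma commute_torus_mx M : M \in unitmx ->
  M *m map_mx intr A = map_mx intr A *m M -> exists2 t : 'rV[C]_n, torus t & M = torus_mx t.
Proof.
move=> Mu comm.
pose t : 'rV[C]_n := \row_l (invmx P *m (M *m col l P)) l 0.
have MP l : M *m col l P = t 0 l *: col l P.
  rewrite mxE; apply: (rotation_eigenvector m_gt1 m_odd eigP AP).
  have Pl : map_mx intr A *m col l P = z ^+ l.+1 *: col l P.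
    rewrite {1}[col l P]colE mulmxA AP -colE mul_mx_diag; apply/colP => i.
    by rewrite !mxE muln1 mulrC.
  by rewrite mulmxA -comm -mulmxA Pl scalemxAr.
exists t => [l|].
  apply/eqP => t0; have := MP l; rewrite t0 scale0r => Ml.
  case/eqP: (eigP.2 l).1; rewrite -[LHS](mulKmx Mu) Ml mulmx0.
  by [].
rewrite /torus_mx; suff -> : P *m diag_mx t = M *m P by rewrite mulmxK.
apply/matrixP => i l; have /matrixP/(_ i 0) := MP l; rewrite mul_mx_diag !mxE.
by rewrite mulrC => <-; apply: eq_bigr => k _; rewrite !mxE.
Qed.

Lemma conjugate_torus_algebraic : algebraic_subgroup_over_rat conjugate_torus.
Proof.
split; last split.
(* All rational polynomials vanishing on the set are taken as equations. Their common zeros commute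
   with the integer matrix [A], hence lie in the torus, and satisfy the conjugate equations by
   [ratpolyX_vanish]. *)
- exists [set p | forall M, conjugate_torus M -> ev M p = 0].
  apply/seteqP; split=> M.
    move=> GM; split=> [|p]; last exact.
    by case: GM => t [tT -> _]; exact: torus_mx_unit.
  move=> [Mu Mp].
  have comm : M *m map_mx intr A = map_mx intr A *m M.
    apply/matrixP => i j; apply/eqP; rewrite -subr_eq0; apply/eqP.
    have [p pE] : ratpoly (fun M : 'M[C]_n =>
        (M *m map_mx intr A) i j - (map_mx intr A *m M) i j).
      apply: ratpolyB.
        apply: ratpoly_ext (ratpoly_sum (index_enum 'I_n) (fun k =>
          ratpolyM (@ratpoly_entry C n i k) (ratpoly_int C n (A k j)))) => N.
        by rewrite mxE; apply: eq_bigr => k _; rewrite mxE.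
      apply: ratpoly_ext (ratpoly_sum (index_enum 'I_n) (fun k =>
        ratpolyM (ratpoly_int C n (A i k)) (@ratpoly_entry C n k j))) => N.
      by rewrite mxE; apply: eq_bigr => k _; rewrite mxE.
    rewrite pE; apply: Mp => N [t [_ -> _]]; rewrite -pE.
    have -> : map_mx intr A = torus_mx (zdiag R m 1) by rewrite /torus_mx -AP mulmxK.
    rewrite !torus_mxM; apply/eqP; rewrite subr_eq0; apply/eqP.
    by congr (torus_mx _ _ _); apply/rowP => k; rewrite !mxE mulrC.
  have [t tT Mt] := commute_torus_mx Mu comm.
  exists t; split=> // u v lt_u lt_v uv; apply/(relation_polyP tT uv).
  rewrite -Mt; apply: (ratpolyX_vanish prim_z ratpolyX_relation_poly _ Mp); last first.
    exact: unit_mod_coprime uv.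
  move=> N w [s [sT -> sP]] co_wm.
  have [w' lt_w' ww'] := coprime_unit_mod m_gt1 co_wm.
  have -> : z ^+ w = z ^+ (w %% m) by rewrite (prim_expr_mod prim_z).
  by apply/(relation_polyP sT ww'); apply: sP ww' => //; rewrite ltn_mod.
- exists (const_mx 1); split=> [j||u v _ _ _]; first by rewrite mxE oner_eq0.
    by rewrite torus_mx1.
  by rewrite /monomial big1 // => j _; rewrite !mxE exp1rz.
- move=> _ _ [s [sT -> sP]] [t [tT -> tP]]; exists (mulr_row s t).
  split=> [||u v lt_u lt_v uv]; [exact: torusM | exact: torus_mxM | ].
  have -> : twist u (mulr_row s t) = mulr_row (twist u s) (twist u t).
    by apply/rowP => j; rewrite !mxE.
  by rewrite monomialMr (sP u v) // (tP u v) // mulr1.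
- move=> _ [t [tT -> tP]]; exists (inv_row t).
  split=> [||u v lt_u lt_v uv]; [exact: torusV | exact: invmx_torus_mx | ].
  have -> : twist u (inv_row t) = inv_row (twist u t).
    by apply/rowP => j; rewrite !mxE.
  by rewrite monomialVr (tP u v) // invr1.
Qed.

(** The exponents of [a] and [b] are the sums of [d] over the set of [u] and over its complement,
    which is the set of the unit [m - u]; both vanish. *)
Lemma relation_hodge u v (a b : C) : relation d -> a != 0 -> b != 0 ->
  (u < m)%N -> (v < m)%N -> (u * v %% m = 1)%N ->
  monomial d (twist u (hodge_row m a b)) = 1.
Proof.
move=> rel a0 b0 lt_u lt_v uv.
have -> : twist u (hodge_row m a b) = \row_j (if in_S m u j then a else b).
  by apply/rowP => j; rewrite !mxE /in_S -(sigmaE j uv).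
rewrite monomial_two_values // (rel u v) // expr0z mul1r.
have [lt_u' lt_v' uv'] := sub_unit_mod lt_u lt_v uv.
rewrite -[RHS](expr0z b) -(rel _ _ lt_u' lt_v' uv'); congr (_ ^ _).
by apply: eq_bigr => j _; rewrite /= (in_S_sub j m_odd lt_u uv).
Qed.

(** [conjugate_torus] is one of the groups intersected in [mumford_tate]; the conjugate with [u = 1]
    is the equation itself. *)
Lemma relation_monomial (t : 'rV[C]_n) :
  relation d -> mumford_tate B (torus_mx t) -> monomial d t = 1.
Proof.
move=> rel /(_ conjugate_torus)[].
  split; first exact: conjugate_torus_algebraic.
  move=> w H w0 /(hodge_mxP m_gt1 m_odd lattB eigP AB AP) ->.
  have w'0 : conjc w != 0 by rewrite conjc_eq0.
  exists (hodge_row m w (conjc w)); split=> // [j|u v lt_u lt_v uv].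
    by rewrite mxE; case: ifP.
  exact: relation_hodge uv.
move=> s [sT /torus_mx_inj -> /(_ 1%N 1%N m_gt1 m_gt1)].
rewrite muln1 modn_small // => /(_ erefl).
suff -> : twist 1 s = s by [].
apply/rowP => j; rewrite mxE; congr (s 0 _); apply: val_inj; apply: succn_inj.
have lt_j := ltn_ord j.
by rewrite (@sigmaE m 1 1) ?muln1 ?mul1n modn_small //; lia.
Qed.

End Relation.

Lemma torus_mxE t r s : torus_mx t r s = \sum_l P r l * invmx P l s * t 0 l.
Proof.
rewrite /torus_mx mul_mx_diag mxE; apply: eq_bigr => l _.
by rewrite mxE mulrAC.
Qed.

Lemma sigmaK u v : (u * v %% m = 1)%N -> cancel (@sigma m v) (@sigma m u).
Proof.
move=> uv j; apply: val_inj; apply: succn_inj; rewrite (sigmaE _ uv).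
have vu : (v * u %% m = 1)%N by rewrite mulnC.
have lt_j := ltn_ord j.
rewrite (sigmaE _ vu) modnMmr mulnA -modnMml uv mul1n modn_small //; lia.
Qed.

Lemma poly_nat_roots_eq0 (q : {poly C}) : (forall k : nat, q.[k%:R] = 0) -> q = 0.
Proof.
move=> q0; apply: (@roots_geq_poly_eq0 _ _ [seq k%:R | k <- iota 0 (size q)]).
- by apply/allP => x /mapP[k _ ->]; apply/rootP.
- by rewrite map_inj_in_uniq ?iota_uniq // => i j _ _ /eqP; rewrite eqr_nat => /eqP.
- by rewrite size_map size_iota.
Qed.

(* A Galois conjugate of the value at [(2, 1)] of the complexified Hodge
   cocharacter. *)
Definition two_row v : 'rV[C]_n := \row_j (if in_S m v j then 2 else 1).

(* The row [hodge_row w (conjc w)] for [w = 3 / 2 + 'i * x] with [x] real; for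
   [x = - 'i / 2] it becomes [hodge_row 2 1]. *)
Definition hodge_curve : 'M[{poly C}]_n := \matrix_(r, s) \sum_l
  (P r l * invmx P l s)%:P * ((3 / 2)%:P + (if (l < g)%N then 'i else - 'i)%:P * 'X).

Lemma hodge_curveE x r s : (hodge_curve r s).[x] =
  torus_mx (hodge_row m (3 / 2 + 'i * x) (3 / 2 - 'i * x)) r s.
Proof.
rewrite torus_mxE mxE horner_sum; apply: eq_bigr => l _.
by rewrite !hornerE mxE; case: ifP => _; rewrite ?mulNr.
Qed.

(* The entries of [torus_mx (hodge_row 2 1)], with the idempotents of [A]
   expanded in powers of [z] and [z] replaced by the variable. *)
Definition galois_curve : 'M[{poly rat}]_n := \matrix_(r, s)
  \sum_(i < n) \sum_(k < m)
    ((if (i < g)%N then 2 else 1) / m%:R * (rot_pow A k r s)%:~R) *: 'X^((m - i.+1) * k).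

(** Substituting [z ^+ u] turns the projection of index [i] into that of index [sigma u i], so index
    [l] receives the value attached to [sigma v l]. *)
Lemma galois_curveE u v r s : (u * v %% m = 1)%N ->
  (map_poly ratr (galois_curve r s)).[z ^+ u] = torus_mx (two_row v) r s.
Proof.
move=> uv; have vu : (v * u %% m = 1)%N by rewrite mulnC.
rewrite torus_mxE mxE rmorph_sum horner_sum.
transitivity (\sum_(i < n) \sum_(k < m) \sum_l P r l * invmx P l s *
   ((if (i < g)%N then 2 else 1) / m%:R *
    (z ^+ ((m - (sigma u i).+1) * k) * zdiag R m k 0 l))).
  apply: eq_bigr => i _; rewrite rmorph_sum horner_sum; apply: eq_bigr => k _.
  rewrite /= map_polyZ hornerZ map_polyXn hornerXn.
  rewrite !rmorphM /= fmorphV rmorph_nat rmorph_int.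
  have -> : (rot_pow A k r s)%:~R = torus_mx (zdiag R m k) r s :> C.
    by rewrite -rot_powE mxE.
  rewrite torus_mxE mulr_sumr mulr_suml; apply: eq_bigr => l _.
  have -> : z ^+ u ^+ ((m - i.+1) * k) = z ^+ ((m - (sigma u i).+1) * k).
    have le_i : (i.+1 <= m)%N by have := ltn_ord i; lia.
    have le_si : ((sigma u i).+1 <= m)%N by have := ltn_ord (sigma u i); lia.
    rewrite [LHS]exprM [RHS]exprM; congr (_ ^+ _).
    rewrite (zeta_expr_sub le_si) exprAC (zeta_expr_sub le_i) (sigmaE _ uv).
    by rewrite [RHS]exprM (prim_expr_mod prim_z) -!exprM; congr (_ ^+ _); lia.
  rewrite (_ : ratr (if (i < g)%N then 2 else 1) = (if (i < g)%N then 2 else 1)); last first.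
    by case: ifP => _; rewrite ?rmorph_nat ?rmorph1.
  set c := _ / _; set a := P r l * _; set b := z ^+ _; set e := zdiag R m k 0 l.
  by rewrite mulrCA -!mulrA [e * b]mulrC.
under eq_bigr do rewrite exchange_big.
rewrite exchange_big; apply: eq_bigr => l _ /=.
under eq_bigr do rewrite -mulr_sumr -mulr_sumr (sum_zdiag R m_gt1 m_odd).
rewrite -mulr_sumr; congr (_ * _).
rewrite (bigD1 (sigma v l)) //= big1 ?addr0 => [|i ne_i].
  rewrite (sigmaK uv) eqxx divfK // mxE /in_S -(sigmaE l vu).
  by [].
case: eqP => [le|_]; last by rewrite mulr0.
by case/eqP: ne_i; rewrite le (sigmaK vu).
Qed.

Lemma mumford_tate_two_row u v : (u * v %% m = 1)%N ->
  mumford_tate B (torus_mx (two_row v)).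
Proof.
move=> uv G [[[S GE] _] hodgeG].
have tT : torus (two_row v).
  by move=> j; rewrite mxE; case: ifP => _; rewrite ?pnatr_eq0 ?oner_eq0.
rewrite GE; split; first exact: torus_mx_unit.
move=> p Sp.
have mxvec_curve (K : nzRingType) (E : 'M[K]_n) (h : K -> C) k :
    mxvec (\matrix_(r, s) h (E r s)) 0 k = h (mxvec E 0 k).
  by case/mxvec_indexP: k => r s; rewrite !mxvecE mxE.
have [q qE] := mmap_curve (@ratr C : {rmorphism rat -> C}) (fun k => mxvec galois_curve 0 k) p.
have evq u' v' : (u' * v' %% m = 1)%N ->
    ev (torus_mx (two_row v')) p = (map_poly ratr q).[z ^+ u'].
  move=> uv'; rewrite -qE; congr (mpoly.mmap _ _ p); apply/funext => k.
  rewrite -(mxvec_curve _ _ (fun e => (map_poly ratr e).[z ^+ u'])).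
  by congr (mxvec _ 0 k); apply/matrixP => r s; rewrite [RHS]mxE (galois_curveE _ _ uv').
(* As [q] is rational, it suffices that it vanishes at [z], which is the case [u = 1]. *)
rewrite (evq _ _ uv); apply/rootP; apply: (root_map_ratr_conj prim_z).
  exact: unit_mod_coprime uv.
apply/rootP; rewrite -[z]expr1 -(evq 1%N 1%N); last by rewrite muln1 modn_small.
have [q' q'E] := mmap_curve (idfun : {rmorphism C -> C}) (fun k => mxvec hodge_curve 0 k) p.
have evq' x : ev (torus_mx (hodge_row m (3 / 2 + 'i * x) (3 / 2 - 'i * x))) p = q'.[x].
  rewrite -[q'](map_poly_id (fun _ _ => erefl)) -q'E.
  congr (mpoly.mmap _ _ p); apply/funext => k.
  rewrite map_poly_id // -(mxvec_curve _ _ (fun e => e.[x])).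
  by congr (mxvec _ 0 k); apply/matrixP => r s; rewrite [RHS]mxE hodge_curveE.
have q'0 : q' = 0.
  (* At [x = k] the two eigenvalues are conjugate, and the matrix is that of [h] at
     [3 / 2 + 'i * k], which belongs to [G]. *)
  apply: poly_nat_roots_eq0 => k; rewrite -evq'.
  have [H HB] := exists_hodge_mx lattB (3 / 2 + 'i * k%:R).
  have w0 : 3 / 2 + 'i * k%:R != 0 :> C.
    apply/eqP => e; have /eqP : (3 / 2 + 'i * k%:R) * (3 / 2 - 'i * k%:R) = 0 :> C.
      by rewrite e mul0r.
    rewrite mulrC -subr_sqr [('i * _) ^+ 2]exprMn sqr_i mulN1r opprK gt_eqF //.
  have := hodgeG _ _ w0 HB; rewrite (hodge_mxP m_gt1 m_odd lattB eigP AB AP HB) GE.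
  rewrite (_ : conjc _ = 3 / 2 - 'i * k%:R); last first.
    rewrite rmorphD rmorphM rmorphM fmorphV !rmorph_nat -mulNr; congr (_ + _ * _).
    by apply: complex_eqP; rewrite /= ?oppr0.
  by move=> [_ /(_ p Sp)].
have <- : hodge_row m (3 / 2 + 'i * (- 'i / 2)) (3 / 2 - 'i * (- 'i / 2)) = two_row 1.
  apply/rowP => j; rewrite !mxE /in_S mul1n modn_small ?ltnS; last by have := ltn_ord j; lia.
  have -> : 'i * (- 'i / 2) = 1 / 2 :> C.
    by rewrite mulNr mulrN mulrA -expr2 sqr_i mulNr opprK.
  by case: ifP => _; field.
by rewrite evq' q'0 horner0.
Qed.

Lemma expr2z_eq1 (k : int) : (2 : C) ^ k = 1 -> k = 0.
Proof.
have H (j : nat) : (2 : C) ^+ j.+1 != 1.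
  by rewrite -natrX pnatr_eq1 gtn_eqF // -{1}(expn0 2) ltn_exp2l.
case: k => [[|j]|j] //= /eqP; first by rewrite (negPf (H j)).
by rewrite /exprz invr_eq1 (negPf (H j)).
Qed.

(** The value of the monomial at [two_row u] is 2 to the power of the sum in question. *)
Lemma equation_relation (d : 'rV[int]_n) :
  (forall t : 'rV[C]_n, torus t -> mumford_tate B (torus_mx t) -> monomial d t = 1) ->
  relation d.
Proof.
move=> eqd u v lt_u lt_v uv; apply: expr2z_eq1.
have vu : (v * u %% m = 1)%N by rewrite mulnC.
rewrite -[RHS](eqd (two_row u)); last exact: mumford_tate_two_row vu; last first.
  by move=> j; rewrite mxE; case: ifP => _; rewrite ?pnatr_eq0 ?oner_eq0.
have two0 : 2 != 0 :> C by rewrite pnatr_eq0.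
rewrite /two_row (monomial_two_values (fun j => in_S m u j) d two0 (oner_neq0 _)).
by rewrite exp1rz mulr1.
Qed.

End MumfordTate.

(** * Ideals of diagonalizable groups *)

Section BinomialIdeals.
Local Open Scope ring_scope.
Local Open Scope complex_scope.
Local Open Scope classical_set_scope.
Variables (R : realType) (m : nat).
Local Notation C := R[i].
Local Notation n := (m.-1).
Local Notation K := (@cyclotomic_field R m).
Implicit Types (f h : 'rV[C]_n -> C) (d e : 'rV[int]_n) (t : 'rV[C]_n).

Lemma cyclotomic_field_rat q : K (ratr q).
Proof. by exists q%:P; rewrite map_polyC hornerC. Qed.

Lemma cyclotomic_field0 : K 0.
Proof. by rewrite -(rmorph0 (@ratr C)); exact: cyclotomic_field_rat. Qed.

Lemma cyclotomic_field1 : K 1.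
Proof. by rewrite -(rmorph1 (@ratr C)); exact: cyclotomic_field_rat. Qed.

Lemma cyclotomic_fieldD a b : K a -> K b -> K (a + b).
Proof. by move=> [p ->] [q ->]; exists (p + q); rewrite rmorphD hornerD. Qed.

Lemma cyclotomic_fieldN a : K a -> K (- a).
Proof. by move=> [p ->]; exists (- p); rewrite rmorphN hornerN. Qed.

Lemma cyclotomic_fieldM a b : K a -> K b -> K (a * b).
Proof. by move=> [p ->] [q ->]; exists (p * q); rewrite rmorphM hornerM. Qed.

Definition lsum (u : seq (C * 'rV[int]_n)) t : C := \sum_(x <- u) x.1 * monomial x.2 t.

Lemma laurentD f h : laurent f -> laurent h -> laurent (fun t => f t + h t).
Proof.
move=> [u [uK uE]] [v [vK vE]]; exists (u ++ v); split.
  by move=> x; rewrite mem_cat => /orP[/uK|/vK].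
by move=> t tT; rewrite uE // vE // big_cat.
Qed.

Lemma laurent_term a d : K a -> laurent (fun t => a * monomial d t).
Proof.
move=> Ka; exists [:: (a, d)]; split; first by move=> x; rewrite inE => /eqP ->.
by move=> t tT; rewrite big_seq1.
Qed.

Lemma laurent_cst a : K a -> @laurent R m (fun=> a).
Proof.
move=> Ka; have [u [uK uE]] := laurent_term 0 Ka; exists u; split=> // t tT.
by rewrite -uE // monomial0 mulr1.
Qed.

Lemma laurentM f h : laurent f -> laurent h -> laurent (fun t => f t * h t).
Proof.
move=> [u [uK uE]] [v [vK vE]].
exists [seq (x.1 * y.1, x.2 + y.2) | x <- u, y <- v]; split.
  by move=> _ /allpairsP[[x y] /= [/uK Kx /vK Ky ->]]; exact: cyclotomic_fieldM.
move=> t tT; rewrite uE // vE // big_allpairs_dep mulr_suml; apply: eq_bigr => x _.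
rewrite mulr_sumr; apply: eq_bigr => y _; rewrite monomialD //=; ring.
Qed.

Lemma laurent_monomial d : laurent (fun t => monomial d t : C).
Proof.
have [u [uK uE]] := laurent_term d cyclotomic_field1.
by exists u; split=> // t tT; rewrite -uE // mul1r.
Qed.

Lemma laurentN f : laurent f -> laurent (fun t => - f t).
Proof.
move=> /(laurentM (laurent_cst (cyclotomic_fieldN cyclotomic_field1)))[u [uK uE]].
by exists u; split=> // t tT; rewrite -uE // mulN1r.
Qed.

Variable s : seq 'rV[int]_n.

Definition binomial_ideal f := exists a : 'I_(size s) -> 'rV[C]_n -> C,
  (forall i, laurent (a i)) /\
  forall t, torus t ->
    f t = \sum_i a i t * (monomial (tnth (in_tuple s) i) t - 1).

Lemma binomial_ideal_ext f h : (forall t, torus t -> f t = h t) ->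
  binomial_ideal f -> binomial_ideal h.
Proof.
by move=> fh [a [aL aE]]; exists a; split=> // t tT; rewrite -fh // aE.
Qed.

Lemma binomial_ideal0 : binomial_ideal (fun=> 0).
Proof.
exists (fun _ _ => 0); split=> [i|t tT]; first exact/laurent_cst/cyclotomic_field0.
by rewrite big1 // => i _; rewrite mul0r.
Qed.

Lemma binomial_idealD f h : binomial_ideal f -> binomial_ideal h ->
  binomial_ideal (fun t => f t + h t).
Proof.
move=> [a [aL aE]] [b [bL bE]]; exists (fun i t => a i t + b i t); split.
  by move=> i; exact: laurentD.
move=> t tT; rewrite aE // bE // -big_split; apply: eq_bigr => i _ /=.
by rewrite mulrDl.
Qed.

Lemma binomial_idealM f h : laurent f -> binomial_ideal h ->
  binomial_ideal (fun t => f t * h t).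
Proof.
move=> fL [a [aL aE]]; exists (fun i t => f t * a i t); split.
  by move=> i; exact: laurentM.
move=> t tT; rewrite aE // mulr_sumr; apply: eq_bigr => i _.
by rewrite mulrA.
Qed.

(** [x^(d+e) - 1 = x^d (x^e - 1) + (x^d - 1)] and [x^(-d) - 1 = - x^(-d) (x^d - 1)]. *)
Lemma binomial_ideal_span d : int_span (fun e => e \in s) d ->
  binomial_ideal (fun t => monomial d t - 1).
Proof.
elim=> {d} [|d e _ Id _ Ie|d _ Id|d sd].
- apply: binomial_ideal_ext binomial_ideal0 => t tT.
  by rewrite monomial0 subrr.
- apply: binomial_ideal_ext
    (binomial_idealD (binomial_idealM (laurent_monomial d) Ie) Id) => t tT.
  by rewrite monomialD //; ring.
- apply: binomial_ideal_ext
    (binomial_idealM (laurentN (laurent_monomial (- d))) Id) => t tT.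
  rewrite mulrBr mulr1 opprK addrC monomialN // mulNr mulVf //.
  exact: monomial_neq0.
- have /tnthP[i iE] : d \in in_tuple s by [].
  exists (fun j _ => if j == i then 1 else 0); split.
    move=> j; apply: laurent_cst; case: ifP => _; first exact: cyclotomic_field1.
    exact: cyclotomic_field0.
  move=> t tT; rewrite (bigD1 i) //= eqxx mul1r -iE big1 ?addr0 // => j /negPf ->.
  by rewrite mul0r.
Qed.

(** * Independence of characters and the vanishing ideal *)

Section Characters.
Variable X : set 'rV[C]_n.
Hypotheses (X1 : X (const_mx 1)) (XM : forall t t', X t -> X t' -> X (mulr_row t t')).
Hypothesis XT : forall t, X t -> torus t.

(** Extension by 0 outside [X] makes equality of functions mean equality on [X]. *)
Definition character d : 'rV[C]_n -> C := fun t => if `[< X t >] then monomial d t else 0.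

Lemma characterP d e :
  character d = character e <-> forall t, X t -> monomial d t = monomial e t.
Proof.
split=> [de t Xt|de].
  by have := congr1 (@^~ t) de; rewrite /character asboolT.
by apply/funext => t; rewrite /character; case: asboolP => // /de.
Qed.

Lemma character_independent u : uniq [seq character x.2 | x <- u] ->
  (forall t, X t -> lsum u t = 0) -> forall x, x \in u -> x.1 = 0.
Proof.
have [k] := ubnP (size u); elim: k u => // k IHk [|x u] //= /ltnSE le_k.
move=> /andP[x_notin uniq_u] u0.
have tail0 y : y \in u -> y.1 = 0.
  move=> yu; have [t0 Xt0 ne] : exists2 t, X t & monomial y.2 t != monomial x.2 t.
    apply: contrapT => eq_xy; case/negP: x_notin; apply/mapP; exists y => //.
    apply/characterP => t Xt; apply/eqP; rewrite eq_sym; apply: contrapT => /negP ne.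
    by apply: eq_xy; exists t.
  (* Dedekind's argument: the relation translated by [t0], minus [monomial x.2 t0] times the
     relation, is shorter because the term of [x] cancels. *)
  pose v := [seq (w.1 * (monomial w.2 t0 - monomial x.2 t0), w.2) | w <- u].
  have : y.1 * (monomial y.2 t0 - monomial x.2 t0) = 0.
    apply: (IHk v _ _ _ (_, y.2)); rewrite ?size_map -?map_comp //; last first.
      exact: map_f.
    move=> t Xt; rewrite /lsum big_map /=.
    have := u0 _ (XM Xt0 Xt); have := u0 _ Xt; rewrite /lsum !big_cons => e1 e2.
    transitivity ((x.1 * monomial x.2 (mulr_row t0 t) +
        \sum_(j <- u) j.1 * monomial j.2 (mulr_row t0 t)) -
      monomial x.2 t0 * (x.1 * monomial x.2 t + \sum_(j <- u) j.1 * monomial j.2 t)).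
      rewrite mulrDr opprD addrACA monomialMr.
      rewrite [X in _ = X + _](_ : _ = 0) ?add0r; last by ring.
      rewrite mulr_sumr -sumrB; apply: eq_bigr => w _.
      by rewrite monomialMr; ring.
    by rewrite e1 e2 mulr0 subrr.
  by move/eqP; rewrite mulf_eq0 subr_eq0 (negPf ne) orbF => /eqP.
move=> y; rewrite inE => /predU1P[->|/tail0 //].
have := u0 _ X1; rewrite /lsum big_cons big_seq big1 ?addr0 => [|w /tail0 ->].
  by move/eqP; rewrite mulf_eq0 (negPf (monomial_neq0 _ (XT X1))) orbF => /eqP.
by rewrite mul0r.
Qed.

Hypothesis X_span : forall d, (forall t, X t -> monomial d t = 1) ->
  int_span (fun e => e \in s) d.
Hypothesis sX : forall d, d \in s -> forall t, X t -> monomial d t = 1.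

Lemma binomial_ideal_vanish f : binomial_ideal f -> forall t, X t -> f t = 0.
Proof.
move=> [a [_ aE]] t Xt; rewrite aE; last exact: XT.
rewrite big1 // => i _; rewrite (sX _ Xt) ?subrr ?mulr0 //.
exact: mem_tnth.
Qed.

Lemma binomial_ideal_character d e : character d = character e ->
  binomial_ideal (fun t => monomial d t - monomial e t).
Proof.
move=> /characterP de; have Ide : binomial_ideal (fun t => monomial (d - e) t - 1).
  apply/binomial_ideal_span/X_span => t Xt.
  have tT := XT Xt; rewrite monomialD // monomialN // de // mulfV //.
  exact: monomial_neq0.
apply: binomial_ideal_ext (binomial_idealM (laurent_monomial e) Ide) => t tT.
by rewrite mulrBr mulr1 -monomialD // [e + _]addrC subrK.
Qed.

(** Terms with the same character on [X] are merged by [binomial_ideal_character]. *)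
Lemma reduce_mod_ideal u : (forall x, x \in u -> K x.1) ->
  exists v, [/\ uniq [seq character x.2 | x <- v], forall x, x \in v -> K x.1 &
    binomial_ideal (fun t => lsum u t - lsum v t)].
Proof.
elim: u => [|x u IHu] uK.
  exists [::]; split=> //; apply: binomial_ideal_ext binomial_ideal0 => t _.
  by rewrite subrr.
have [y yu|v [uniq_v vK Iv]] := IHu; first by apply: uK; rewrite inE yu orbT.
have Kx : K x.1 by apply: uK; rewrite mem_head.
have [/mapP[y yv xy]|x_notin] := boolP (character x.2 \in [seq character w.2 | w <- v]).
  exists ((x.1 + y.1, y.2) :: rem y v); split.
  - suff : perm_eq [seq character w.2 | w <- v]
      [seq character w.2 | w <- (x.1 + y.1, y.2) :: rem y v].
      by move/perm_uniq => <-.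
    exact: (perm_map (fun w => character w.2) (perm_to_rem yv)).
  - move=> w; rewrite inE => /predU1P[->|/mem_rem/vK //].
    by apply: cyclotomic_fieldD => //; exact: vK.
  - apply: binomial_ideal_ext (binomial_idealD
      (binomial_idealM (laurent_cst Kx) (binomial_ideal_character xy)) Iv) => t tT.
    rewrite /lsum !big_cons (perm_big _ (perm_to_rem yv)) big_cons /=; ring.
exists (x :: v); split; first by rewrite /= x_notin.
  by move=> w; rewrite inE => /predU1P[->|/vK].
apply: binomial_ideal_ext Iv => t tT.
by rewrite /lsum !big_cons opprD addrACA subrr add0r.
Qed.

(** Modulo the ideal, [f] is a combination of distinct characters. It vanishes on [X], so its
    coefficients are 0. *)
Lemma vanish_binomial_ideal f : laurent f -> (forall t, X t -> f t = 0) -> binomial_ideal f.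
Proof.
move=> [u [uK uE]] f0; have [v [uniq_v vK Iv]] := reduce_mod_ideal uK.
have v0 t : X t -> lsum v t = 0.
  move=> Xt; have := binomial_ideal_vanish Iv Xt.
  rewrite {1}/lsum -(uE t (XT Xt)) (f0 t Xt) sub0r.
  by move/eqP; rewrite oppr_eq0 => /eqP.
apply: binomial_ideal_ext Iv => t tT; rewrite uE // -[RHS]subr0; congr (_ - _).
by rewrite /lsum big_seq big1 // => x /(character_independent uniq_v v0) ->; rewrite mul0r.
Qed.

End Characters.
End BinomialIdeals.

Theorem corollary4p2p5 :
  exists F : forall m : nat, seq 'rV[int]_(m.-1),
    computable_vectors F /\
    forall (R : realType) (m : nat), (1 < m)%N -> odd m ->
    forall (B : 'M[R[i]]_(m.-1, m./2)) (P : 'M[R[i]]_(m.-1)),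
      lattice_basis B -> eigenbasis B P ->
      equations_define_MT B P (F m).
Proof.
exists generators; split; first exact: computable_generators.
move=> R m m_gt1 m_odd B P lattB eigP.
have [A [AB AP]] := exists_rotation_mx m_gt1 lattB eigP.
have Pu := eigenbasis_unit m_gt1 m_odd eigP AP.
have rel_mon := relation_monomial m_gt1 m_odd lattB eigP AB AP.
split=> [d /generators_relation rel|f [fL f0]].
  split; first exact/laurentD/laurentN/laurent_cst/cyclotomic_field1/laurent_monomial.
  by move=> t tT MTt; rewrite (rel_mon _ _ rel MTt) subrr.
(* [X] is the group of points of [MT(J_m)] in the torus; the characters trivial on it are the
   solutions of [relation], spanned by [generators]. *)
pose X := [set t : 'rV[R[i]]_(m.-1) | torus t /\ mumford_tate B (torus_mx P t)]%classic.
have XT t : X t -> torus t by case.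
apply: (vanish_binomial_ideal (X := X)) => //.
- split=> [j|]; first by rewrite mxE oner_eq0.
  rewrite (torus_mx1 m_gt1 m_odd eigP AP) => G [[_ [G1 _ _]] _].
  exact: G1.
- move=> t t' [tT MTt] [t'T MTt']; split; first exact: torusM.
  rewrite -(torus_mxM m_gt1 m_odd eigP AP) => G GP; have [[_ [_ GM _]] _] := GP.
  by apply: GM; [exact: MTt | exact: MTt'].
- move=> d dX; apply: int_span_generators.
  apply: (equation_relation m_gt1 m_odd lattB eigP AB AP) => t tT MTt.
  by apply: dX.
- move=> d /generators_relation rel t [tT MTt].
  exact: rel_mon MTt.
- by move=> t [tT MTt]; exact: f0.
Qed.
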